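(* Let $\widetilde{W}/W\in\{\widetilde{C}_n/C_n,\widetilde{B}_n/B_n,\widetilde{B}_n/D_n,\widetilde{D}_n/D_n\}$. The root lattice coordinate of an element $w\in\widetilde{W}/W$ (the image of $0\in V$ under $w$) is $$\sum_{i=1}^n \mathrm{level}_i(\mathcal{A}(w))\,e_i,$$ where $\mathrm{level}_i(\mathcal{A}(w))$ denotes the level of the lowest bead in column $i$ of the abacus $\mathcal{A}(w)$. Moreover, this gives a bijection from $\widetilde{W}/W$ onto the following set of points $\sum_i a_ie_i$: all $(a_1,\dots,a_n)\in\mathbb{Z}^n$ in types $\widetilde{C}/C$ and $\widetilde{B}/D$; all $(a_1,\dots,a_n)\in\mathbb{Z}^n$ with $\sum_{i=1}^n|a_i|$ even in types $\widetilde{B}/B$ and $\widetilde{D}/D$.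
   Context: Groups. Let $N=2n+1$. A mirrored $\mathbb{Z}$-permutation is a bijection $w:\mathbb{Z}\to\mathbb{Z}$ with $w(i+N)=w(i)+N$ and $w(-i)=-w(i)$ for all $i\in\mathbb{Z}$; it is determined by $(w(1),\dots,w(n))$. Under composition these form the affine Coxeter group $\widetilde{C}_n$. Define elements by their images $(w(1),\dots,w(n))$: $s_i=(1,\dots,i-1,i+1,i,i+2,\dots,n)$ for $1\le i\le n-1$; $s_0^C=(-1,2,3,\dots,n)$; $s_0^D=(-2,-1,3,\dots,n)$; $s_n^C=(1,\dots,n-1,n+1)$; $s_n^D=(1,\dots,n-2,n+1,n+2)$. The four types are: - $\widetilde{C}/C$: $\widetilde{W}=\widetilde{C}_n$ is all mirrored $\mathbb{Z}$-permutations, generators $s_0=s_0^C,s_1,\dots,s_{n-1},s_n=s_n^C$ ($n\ge2$). - $\widetilde{B}/B$: those with $|\{i\le0:w(i)\ge1\}|$ even, generators $s_0=s_0^D,s_1,\dots,s_{n-1},s_n=s_n^C$ ($n\ge3$). - $\widetilde{B}/D$: those with $|\{i\le n:w(i)\ge n+1\}|$ even, generators $s_0=s_0^C,s_1,\dots,s_{n-1},s_n=s_n^D$ ($n\ge3$). - $\widetilde{D}/D$: those satisfying both parity conditions, generators $s_0=s_0^D,s_1,\dots,s_{n-1},s_n=s_n^D$ ($n\ge4$). $W$ is generated by $s_1,\dots,s_n$, and $\widetilde{W}/W$ denotes the set of minimal length representatives of the cosets $wW$. Abaci. An abacus has runners (columns) $1,\dots,2n$; runner $i$ has entries labeled $mN+i$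 for each level $m\in\mathbb{Z}$. Some entries are beads, the others gaps. ''Lowest'' means largest label. The abacus is flush if no bead is preceded (in the order of labels) by a gap on the same runner. $\mathcal{A}(w)$ is the flush abacus whose lowest bead in each runner is an element of $\{w(1),\dots,w(2n)\}$. Action on $V$. $V=\mathbb{R}^n$ with orthonormal basis $e_1,\dots,e_n$ and inner product $\langle\cdot,\cdot\rangle$. $\widetilde{W}$ acts on $V$ with $s_i$ ($1\le i\le n$) acting as the reflection across the hyperplane perpendicular to the simple root $\alpha_i$, and $s_0$ acting as the affine reflection $s_0(v)=v-(\langle v,\widetilde{\alpha}\rangle-1)\frac{2}{\langle\widetilde{\alpha},\widetilde{\alpha}\rangle}\widetilde{\alpha}$. Here $\alpha_i=e_i-e_{i+1}$ for $1\le i\le n-1$; $\alpha_n=2e_n$ in type $\widetilde{C}/C$, $\alpha_n=e_n$ in type $\widetilde{B}/B$, $\alpha_n=e_{n-1}+e_n$ in types $\widetilde{B}/D$ and $\widetilde{D}/D$; and $\widetilde{\alpha}=2e_1$ in types $\widetilde{C}/C,\widetilde{B}/D$, $\widetilde{\alpha}=e_1+e_2$ in types $\widetilde{B}/B,\widetilde{D}/D$. The root lattice coordinate of $w\in\widetilde{W}/W$ is $w(0)\in V$, the result of acting by $w$ on $0$. *)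

(* Defs.v *)
From HB Require Import structures.
From mathcomp Require Import all_boot all_order all_algebra.
From mathcomp Require Import boolp classical_sets functions cardinality reals.
From mathcomp Require Import zify ring lra.

Set Implicit Arguments.
Unset Strict Implicit.
Unset Printing Implicit Defensive.

Import Order.TTheory GRing.Theory Num.Theory.

Local Open Scope classical_set_scope.
Local Open Scope ring_scope.

(* The parabolic quotients C~/C, B~/B, B~/D and D~/D. *)
Inductive quotient_type := CC | BB | BD | DD.

Definition min_rank (t : quotient_type) : nat :=
  match t with CC => 2 | BB => 3 | BD => 3 | DD => 4 end.

Definition period (n : nat) : int := (2 * n + 1)%N%:Z.

Definition mirrored (n : nat) (w : int -> int) : Prop :=
  [/\ bijective w,
      forall i, w (i + period n) = w i + period n &
      forall i, w (- i) = - w i].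

Definition even_card (A : set int) : Prop :=
  exists2 k : nat, ~~ odd k & (A #= `I_k)%card.

Definition even_at_0 (w : int -> int) : Prop :=
  even_card [set i | i <= 0 /\ 1 <= w i].

Definition even_at_n (n : nat) (w : int -> int) : Prop :=
  even_card [set i | i <= n%:Z /\ n%:Z + 1 <= w i].

Definition affine_group (t : quotient_type) (n : nat) : set (int -> int) :=
  match t with
  | CC => [set w | mirrored n w]
  | BB => [set w | mirrored n w /\ even_at_0 w]
  | BD => [set w | mirrored n w /\ even_at_n n w]
  | DD => [set w | [/\ mirrored n w, even_at_0 w & even_at_n n w]]
  end.

(* The map w with w j = f j for 1 <= j <= n, extended to int by the rules
   w (i + period n) = w i + period n and w (- i) = - w i. *)
Definition mirror_ext (n : nat) (f : nat -> int) (z : int) : int :=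
  let r := `|(z %% period n)%Z|%N in
  (z %/ period n)%Z * period n +
  (if r == 0%N then 0
   else if (r <= n)%N then f r
   else period n - f (2 * n + 1 - r)%N).

Definition s_mid (i j : nat) : int :=
  if j == i then i%:Z + 1 else if j == i.+1 then i%:Z else j%:Z.
Definition s0C (j : nat) : int := if j == 1%N then - 1 else j%:Z.
Definition s0D (j : nat) : int :=
  if j == 1%N then - 2 else if j == 2%N then - 1 else j%:Z.
Definition snC (n j : nat) : int := if j == n then n%:Z + 1 else j%:Z.
Definition snD (n j : nat) : int :=
  if j == n.-1 then n%:Z + 1 else if j == n then n%:Z + 2 else j%:Z.

Definition gen_window (t : quotient_type) (n i : nat) : nat -> int :=
  if i == 0%N then match t with CC | BD => s0C | BB | DD => s0D end
  else if (i < n)%N then s_mid i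
  else match t with CC | BB => snC n | BD | DD => snD n end.

Definition gen (t : quotient_type) (n i : nat) : int -> int :=
  mirror_ext n (gen_window t n i).

Definition word_prod (t : quotient_type) (n : nat) (s : seq 'I_n.+1) :
    int -> int :=
  foldr (fun (i : 'I_n.+1) w => gen t n i \o w) id s.

Definition parabolic (t : quotient_type) (n : nat) : set (int -> int) :=
  [set w | exists2 s : seq 'I_n.+1, ord0 \notin s & w = word_prod t s].

Definition coxeter_length (t : quotient_type) (n : nat) (w : int -> int) :
    nat :=
  xget 0%N [set k | (exists2 s : seq 'I_n.+1, size s = k & w = word_prod t s)
                 /\ forall s : seq 'I_n.+1, w = word_prod t s -> (k <= size s)%N].

Definition min_coset_reps (t : quotient_type) (n : nat) : set (int -> int) :=
  [set w | affine_group t n w /\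
           forall u, parabolic t n u ->
             (coxeter_length t n w <= coxeter_length t n (w \o u))%N].

(* An abacus is given by the set of labels of its beads. *)
Definition label (n : nat) (m : int) (i : nat) : int := m * period n + i%:Z.

Definition entries (n : nat) : set int :=
  [set z | exists m i, (1 <= i <= 2 * n)%N /\ z = label n m i].

Definition flush (n : nat) (B : set int) : Prop :=
  forall (i : nat) (m m' : int), (1 <= i <= 2 * n)%N -> m <= m' ->
    B (label n m' i) -> B (label n m i).

Definition lowest_bead (n : nat) (B : set int) (i : nat) (m : int) : Prop :=
  B (label n m i) /\ forall m', B (label n m' i) -> m' <= m.

Definition is_abacus_of (n : nat) (w : int -> int) (B : set int) : Prop :=
  [/\ B `<=` entries n,
      flush n B &
      forall i : nat, (1 <= i <= 2 * n)%N ->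
        exists2 m, lowest_bead n B i m &
        exists2 k : nat, (1 <= k <= 2 * n)%N & label n m i = w k%:Z].

(* Well defined for mirrored w: see abacus_ofP and abacus_of_unique. *)
Definition abacus (n : nat) (w : int -> int) : set int :=
  xget set0 (is_abacus_of n w).

Definition level (n : nat) (B : set int) (i : nat) : int :=
  xget 0 (lowest_bead n B i).

Section Space.
Variables (R : realType) (t : quotient_type) (n : nat).
Implicit Types u v : 'rV[R]_n.

(* Basis vectors are numbered from 1. *)
Definition evec (i : nat) : 'rV[R]_n := \row_(j < n) (j.+1 == i)%:R.

Definition dot u v : R := \sum_i u 0 i * v 0 i.

Definition simple_root (i : nat) : 'rV[R]_n :=
  if (i < n)%N then evec i - evec i.+1
  else match t with
       | CC => 2 *: evec n
       | BB => evec n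
       | BD | DD => evec n.-1 + evec n
       end.

Definition affine_root : 'rV[R]_n :=
  match t with CC | BD => 2 *: evec 1%N | BB | DD => evec 1%N + evec 2%N end.

Definition gen_reflection (i : nat) v : 'rV[R]_n :=
  if i == 0%N then
    v - ((dot v affine_root - 1) * (2 / dot affine_root affine_root))
          *: affine_root
  else
    v - (dot v (simple_root i) * (2 / dot (simple_root i) (simple_root i)))
          *: simple_root i.

(* Such an action exists: see geometric_action_exists. *)
Record geometric_action (act : (int -> int) -> 'rV[R]_n -> 'rV[R]_n) : Prop :=
  GeometricAction {
    action_id : forall v, act id v = v;
    action_comp : forall w w' v, affine_group t n w -> affine_group t n w' ->
      act (w \o w') v = act w (act w' v);
    action_gen : forall (i : nat) v, (i <= n)%N ->
      act (gen t n i) v = gen_reflection i v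
  }.

Definition integer_points : set 'rV[R]_n :=
  [set v | exists a : 'I_n -> int,
     match t with
     | CC | BD => True
     | BB | DD => ~~ odd (\sum_i `|a i|)%N
     end /\ v = \sum_i (a i)%:~R *: evec i.+1].

End Space.

Lemma intN_split (n : nat) (z : int) : exists m : int, exists r : nat,
  (r <= 2 * n)%N /\ z = m * period n + r%:Z.
Proof.
have P0 : period n != 0 by rewrite /period; lia.
exists (z %/ period n)%Z, `|(z %% period n)%Z|%N; split.
  have := ltz_mod z P0; rewrite /period; lia.
by rewrite gez0_abs ?modz_ge0 // -divz_eq.
Qed.

Lemma intN_inj (n : nat) (m m' : int) (r r' : nat) :
  (r <= 2 * n)%N -> (r' <= 2 * n)%N ->
  m * period n + r%:Z = m' * period n + r'%:Z -> m = m' /\ r = r'.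
Proof.
rewrite /period => hr hr' h.
have [hm|hm] := eqVneq m m'; first by subst; split => //; lia.
exfalso.
have : m <= m' - 1 \/ m >= m' + 1 by lia.
by case=> ?; nia.
Qed.

Lemma mirror_extE (n : nat) f (m : int) (r : nat) : (r <= 2 * n)%N ->
  mirror_ext n f (m * period n + r%:Z) = m * period n +
  (if r == 0%N then 0
   else if (r <= n)%N then f r
   else period n - f (2 * n + 1 - r)%N).
Proof.
move=> hr; rewrite /mirror_ext.
have P0 : period n != 0 by rewrite /period; lia.
have r0 : (0 <= r%:Z < `|period n|)%R by rewrite /period; lia.
by rewrite divzMDl // modzMDl divz_small // addr0 modz_small.
Qed.

Lemma mirror_extD (n : nat) f (i : int) :
  mirror_ext n f (i + period n) = mirror_ext n f i + period n.
Proof.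
have [m [r [hr ->]]] := intN_split n i.
rewrite (_ : _ + _ + _ = (m + 1) * period n + r%:Z); last by ring.
rewrite !mirror_extE //; ring.
Qed.

Lemma mirror_extN (n : nat) f (i : int) :
  mirror_ext n f (- i) = - mirror_ext n f i.
Proof.
have [m [r [hr ->]]] := intN_split n i.
have [->|r0] := eqVneq r 0%N.
  rewrite (_ : - _ = (- m) * period n + 0%N%:Z); last by ring.
  rewrite !mirror_extE //=; ring.
have hr' : (2 * n + 1 - r <= 2 * n)%N by lia.
rewrite (_ : - _ = (- m - 1) * period n + (2 * n + 1 - r)%N%:Z); last first.
  rewrite -subzn ?/period; [ring | lia].
rewrite !mirror_extE // (negbTE r0).
have -> : (2 * n + 1 - r == 0)%N = false by lia.
have -> : (2 * n + 1 - (2 * n + 1 - r) = r)%N by lia.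
case: ifP => h1; case: ifP => h2; try lia; ring.
Qed.

Lemma mirror_ext_window (n : nat) f (j : nat) : (1 <= j <= n)%N ->
  mirror_ext n f j%:Z = f j.
Proof.
move=> hj; rewrite -[j%:Z]add0r -[0](mul0r (period n)) mirror_extE; last lia.
by rewrite mul0r add0r; case: ifP; [lia | case: ifP => //; lia].
Qed.

(* Functions with the quasi-periodicity and mirror symmetry x i |-> b + c i
   are determined by their values on 1, ..., n. *)
Lemma window_eq (F : numDomainType) (n : nat) (c b : F) (f g : int -> F) :
  (forall i, f (i + period n) = f i + c) ->
  (forall i, g (i + period n) = g i + c) ->
  (forall i, f (- i) = b - f i) -> (forall i, g (- i) = b - g i) ->
  (forall j : nat, (1 <= j <= n)%N -> f j%:Z = g j%:Z) ->
  f =1 g.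
Proof.
move=> fD gD fN gN fg.
have f0 : f 0 = g 0.
  have := fN 0; have := gN 0; rewrite oppr0 => h1 h2.
  have h3 : f 0 *+ 2 = g 0 *+ 2.
    by rewrite !mulr2n {1}h2 {1}h1 !subrK.
  by apply/eqP; rewrite -(eqr_pMn2r (n:=2)) // h3.
have key (i : int) : f i = g i -> f (- i) = g (- i).
  by move=> h; rewrite fN gN h.
have keyD (i : int) : f i = g i <-> f (i + period n) = g (i + period n).
  by rewrite fD gD; split => [->|/addIr].
have keyM (m : int) (i : int) : f i = g i -> f (m * period n + i) = g (m * period n + i).
  move=> h; elim/int_rect: m => [|k ih|k ih].
  - by rewrite mul0r add0r.
  - rewrite (_ : _ + i = (k%:Z * period n + i) + period n); last by rewrite -addn1 PoszD; ring.
    exact: (proj1 (keyD _)).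
  - apply: (proj2 (keyD _)); rewrite (_ : _ + i + _ = (- k%:Z * period n + i)) //.
    by rewrite -addn1 PoszD; ring.
move=> z; have [m [r [hr ->]]] := intN_split n z; apply: (keyM).
have [->|r0] := eqVneq r 0%N => //.
have [rn|rn] := leqP r n; first by apply: fg; lia.
rewrite (_ : r%:Z = 1 * period n + - (2 * n + 1 - r)%N%:Z); last first.
  rewrite -subzn ?/period; [ring|lia].
apply: (keyM); apply: (key); apply: fg. lia.
Qed.

Lemma mirrored0 (n : nat) w : mirrored n w -> w 0 = 0.
Proof. by move=> [_ _ /(_ 0)]; rewrite oppr0; set x : int := w 0; lia. Qed.

Lemma mirroredM (n : nat) w (m i : int) : mirrored n w ->
  w (m * period n + i) = m * period n + w i.
Proof.
move=> [_ wD _]; elim/int_rect: m => [|k ih|k ih].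
- by rewrite !mul0r !add0r.
- rewrite (_ : _ + i = (k%:Z * period n + i) + period n); last by rewrite -addn1 PoszD; ring.
  by rewrite wD ih -addn1 PoszD; ring.
- apply: (@addIr _ (period n)); rewrite -wD.
  rewrite (_ : _ + i + _ = (- k%:Z * period n + i)); last by rewrite -addn1 PoszD; ring.
  by rewrite ih -addn1 PoszD; ring.
Qed.

Lemma is_abacus_of_exists (n : nat) w : mirrored n w ->
  exists B, is_abacus_of n w B.
Proof.
move=> mw; have [[v vK wK] _ _] := mw.
exists [set z | exists i m m', [/\ (1 <= i <= 2 * n)%N, z = label n m i,
  m <= m' & exists2 k : nat, (1 <= k <= 2 * n)%N & label n m' i = w k%:Z]].
have inj (i i' : nat) m m' : (1 <= i <= 2 * n)%N -> (1 <= i' <= 2 * n)%N ->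
    label n m i = label n m' i' -> m = m' /\ i = i'.
  by move=> hi hi' /intN_inj h; apply: h; lia.
split.
- by move=> z [i [m [m' [hi -> _ _]]]]; exists m, i.
- move=> i m m' hi mm' [i2 [m2 [m3 [hi2 /(inj _ _ _ _ hi hi2)[<- <-] h3 h4]]]].
  by exists i, m, m3; split => //; apply: le_trans h3.
- move=> i hi.
  have [m [r [hr ez]]] := intN_split n (v i%:Z).
  have wr : label n (- m) i = w r%:Z.
    have := congr1 w ez; rewrite wK mirroredM // /label => ->; ring.
  have r0 : (1 <= r)%N.
    case: (r) wr => // /esym; rewrite (mirrored0 mw) /label => h.
    have /intN_inj H : (0 : int) * period n + 0%N%:Z = - m * period n + i%:Z.
      by rewrite -h; ring.
    by have [] := H _ _; lia.
  exists (- m); last by exists r => //; lia.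
  split; first by exists i, (- m), (- m); split => //; exists r => //; lia.
  move=> m' [i2 [m2 [m3 [hi2 /(inj _ _ _ _ hi hi2)[<- <-] h3 [k hk h4]]]]].
  apply: (le_trans h3).
  have /(can_inj vK) : w k%:Z = w ((m3 + m) * period n + r%:Z).
    by rewrite mirroredM // -wr -h4 /label; ring.
  rewrite -[LHS]add0r -[X in X + _](mul0r (period n)).
  by move/intN_inj => h; have [] := h _ _; lia.
Qed.

Lemma abacus_ofP (n : nat) w : mirrored n w -> is_abacus_of n w (abacus n w).
Proof. by move=> /is_abacus_of_exists; apply: xgetPex. Qed.

Lemma abacus_of_unique (n : nat) w B : mirrored n w ->
  is_abacus_of n w B -> B = abacus n w.
Proof.
move=> mw hB; have hA := abacus_ofP mw; have [[v vK wK] _ _] := mw.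
suff sub A C : is_abacus_of n w A -> is_abacus_of n w C -> A `<=` C.
  by apply/seteqP; split; apply: sub.
move=> [Ae _ Aw] [_ Cf Cw] z Az.
have [m [i [hi ez]]] := Ae _ Az; rewrite {}ez in Az *.
have [m1 [_ /(_ _ Az) le1] [k hk e1]] := Aw _ hi.
have [m2 [C2 _] [k2 hk2 e2]] := Cw _ hi.
suff e12 : m1 = m2 by apply: Cf C2 => //; rewrite -e12.
have /(can_inj vK) : w k%:Z = w ((m1 - m2) * period n + k2%:Z).
  by rewrite mirroredM // -e1 -e2 /label; ring.
rewrite -[LHS]add0r -[X in X + _](mul0r (period n)).
by move/intN_inj => h; have [] := h _ _; lia.
Qed.

Lemma gen_neg (t : quotient_type) (n i j : nat) : (1 <= j <= n)%N ->
  gen t n i (- j%:Z) = - gen_window t n i j.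
Proof. by move=> hj; rewrite /gen mirror_extN mirror_ext_window. Qed.

Lemma gen_refl (t : quotient_type) (n i j : nat) : (1 <= j <= n)%N ->
  gen t n i (- j%:Z + period n) = - gen_window t n i j + period n.
Proof. by move=> hj; rewrite -gen_neg // /gen mirror_extD. Qed.

Lemma genK (t : quotient_type) (n i : nat) :
  (2 <= n)%N -> (i <= n)%N -> involutive (gen t n i).
Proof.
move=> n2 hi.
have H (j j' : nat) (z : int) : (1 <= j <= n)%N ->
   gen_window t n i j = z ->
   z = - j'%:Z \/ z = j'%:Z \/ z = - j'%:Z + period n ->
   (1 <= j' <= n)%N ->
   (z = - j'%:Z -> gen_window t n i j' = - j%:Z) ->
   (z = j'%:Z -> gen_window t n i j' = j%:Z) ->
   (z = - j'%:Z + period n -> gen_window t n i j' = - j%:Z + period n) ->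
   gen t n i (gen t n i j%:Z) = j%:Z.
  move=> hj hz + hj' h1 h2 h3.
  rewrite {2}/gen mirror_ext_window // hz.
  case=> [e|[e|e]]; rewrite e.
  - by rewrite gen_neg // h1 // opprK.
  - by rewrite /gen mirror_ext_window // -h2.
  - by rewrite gen_refl // h3 // opprD opprK addrNK.
apply: (@window_eq int n (period n) 0) => //.
- by move=> z; rewrite /gen !mirror_extD.
- by move=> z; rewrite /gen !mirror_extN sub0r.
- by move=> z; rewrite sub0r.
move=> j hj.
pose j' : nat :=
  if i == 0%N then match t with CC | BD => j
    | _ => if j == 1%N then 2%N else if j == 2%N then 1%N else j end
  else if (i < n)%N then if j == i then i.+1 else if j == i.+1 then i else j
  else match t with CC | BB => j
    | _ => if j == n.-1 then n else if j == n then n.-1 else j end.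
have hj' : (1 <= j' <= n)%N.
  rewrite /j'; case: ifP => ?; [|case: ifP => ?]; try case: (t);
    repeat case: ifP => ?; lia.
apply: (H j j' _ hj erefl _ hj'); clear hj' H; rewrite /gen_window {}/j';
  (case: ifP => ?; [|case: ifP => ?]; try case: (t));
  rewrite /s0C /s0D /s_mid /snC /snD /period;
  repeat case: ifP => ?; first [lia | rewrite /=; lia].
Qed.

Lemma gen_mirrored (t : quotient_type) (n i : nat) :
  (2 <= n)%N -> (i <= n)%N -> mirrored n (gen t n i).
Proof.
move=> n2 hi; split; first by exists (gen t n i); apply: genK.
- exact: mirror_extD.
- exact: mirror_extN.
Qed.

Section ActionExists.
Variables (R : realType) (t : quotient_type) (n : nat).
Implicit Types u v : 'rV[R]_n.

Lemma dot_evec v (j : 'I_n) : dot v (evec R n j.+1) = v 0 j.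
Proof.
rewrite /dot (bigD1 j) //= big1 => [|k kj]; rewrite !mxE ?eqxx ?addr0 ?mulr1 //.
by rewrite eqSS (inj_eq val_inj) (negbTE kj) mulr0.
Qed.

Lemma dotDr v x y : dot v (x + y) = dot v x + dot v y :> R.
Proof. by rewrite /dot -big_split; apply: eq_bigr => i _; rewrite mxE mulrDr. Qed.

Lemma dotZr v (a : R) x : dot v (a *: x) = a * dot v x.
Proof. by rewrite /dot mulr_sumr; apply: eq_bigr => i _; rewrite mxE mulrCA. Qed.

Lemma dotNr v x : dot v (- x) = - dot v x :> R.
Proof. by rewrite -scaleN1r dotZr mulN1r. Qed.

Lemma dotC x (y : 'rV[R]_n) : dot x y = dot y x :> R.
Proof. by apply: eq_bigr => i _; rewrite mulrC. Qed.

Lemma dotDl v x y : dot (x + y) v = dot x v + dot y v :> R.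
Proof. by rewrite ![dot _ v]dotC dotDr. Qed.

Lemma dotNl v x : dot (- x) v = - dot x v :> R.
Proof. by rewrite ![dot _ v]dotC dotNr. Qed.

Lemma dot_evec2 (i j : nat) : (1 <= i <= n)%N -> (1 <= j <= n)%N ->
  dot (evec R n i) (evec R n j) = (i == j)%:R.
Proof.
move=> hi; case: j => // j hj.
by rewrite (dot_evec _ (Ordinal hj)) mxE eq_sym.
Qed.

(* A point v of V is extended to a function on int satisfying
   h (i + period n) = h i - 1 and h (- i) = 1 - h i; the action is then
   composition with the inverse. *)
Definition hat v (z : int) : R :=
  let r := `|(z %% period n)%Z|%N in
  (if r == 0%N then 2^-1
   else if (r <= n)%N then dot v (evec R n r)
   else - dot v (evec R n (2 * n + 1 - r)%N)) - ((z %/ period n)%Z)%:~R.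

Lemma hatE v (m : int) (r : nat) : (r <= 2 * n)%N ->
  hat v (m * period n + r%:Z) =
  (if r == 0%N then 2^-1
   else if (r <= n)%N then dot v (evec R n r)
   else - dot v (evec R n (2 * n + 1 - r)%N)) - m%:~R.
Proof.
move=> hr; rewrite /hat.
have P0 : period n != 0 by rewrite /period; lia.
have r0 : (0 <= r%:Z < `|period n|)%R by rewrite /period; lia.
by rewrite divzMDl // modzMDl divz_small // addr0 modz_small.
Qed.

Lemma hatD v (i : int) : hat v (i + period n) = hat v i + (- 1).
Proof.
have [m [r [hr ->]]] := intN_split n i.
rewrite (_ : _ + _ + _ = (m + 1) * period n + r%:Z); last by ring.
by rewrite !hatE // rmorphD /= opprD addrA.
Qed.

Lemma hatN v (i : int) : hat v (- i) = 1 - hat v i.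
Proof.
have [m [r [hr ->]]] := intN_split n i.
have [->|r0] := eqVneq r 0%N.
  rewrite (_ : - _ = (- m) * period n + 0%N%:Z); last by ring.
  rewrite !hatE //= rmorphN /=; by field.
have hr' : (2 * n + 1 - r <= 2 * n)%N by lia.
rewrite (_ : - _ = (- m - 1) * period n + (2 * n + 1 - r)%N%:Z); last first.
  rewrite -subzn ?/period; [ring | lia].
rewrite !hatE // (negbTE r0).
have -> : (2 * n + 1 - r == 0)%N = false by lia.
have -> : (2 * n + 1 - (2 * n + 1 - r) = r)%N by lia.
rewrite rmorphB rmorphN /=.
case: ifP => h1; case: ifP => h2; try lia; ring.
Qed.

Lemma hat_window v (j : nat) : (1 <= j <= n)%N -> hat v j%:Z = dot v (evec R n j).
Proof.
move=> hj; rewrite -[j%:Z]add0r -[0](mul0r (period n)) hatE; last lia.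
by rewrite subr0; case: ifP; [lia | case: ifP => //; lia].
Qed.

Definition int_preim (w : int -> int) (z : int) : int := xget 0 [set k | w k = z].

Lemma int_preimE w w' : cancel w w' -> cancel w' w -> int_preim w = w'.
Proof.
move=> h h'; apply/funext => z; apply: xget_unique; first exact: h'.
by move=> k /= <-.
Qed.

Definition act0 (w : int -> int) v : 'rV[R]_n :=
  \row_(j < n) hat v (int_preim w j.+1%:Z).

Lemma hat_act0 w v z : mirrored n w -> hat (act0 w v) z = hat v (int_preim w z).
Proof.
move=> [[w' wK w'K] wD wN]; rewrite (int_preimE wK w'K).
have w'D i : w' (i + period n) = w' i + period n.
  by apply: (can_inj wK); rewrite wD !w'K.
have w'N i : w' (- i) = - w' i by apply: (can_inj wK); rewrite wN !w'K.
move: z; apply: (@window_eq R n (- 1) 1) => [z|z|z|z|j hj].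
- exact: hatD.
- by rewrite w'D hatD.
- exact: hatN.
- by rewrite w'N hatN.
have hj' : (j.-1 < n)%N by lia.
rewrite hat_window // -[in LHS](prednK (n:=j)); last lia.
rewrite (dot_evec _ (Ordinal hj')) mxE /= prednK; last lia.
by rewrite (int_preimE wK w'K).
Qed.

Lemma affine_group_mirrored w : affine_group t n w -> mirrored n w.
Proof. by rewrite /affine_group; case: t => //= -[]. Qed.

Lemma geometric_action_exists : (2 <= n)%N ->
  exists act : (int -> int) -> 'rV[R]_n -> 'rV[R]_n, geometric_action t act.
Proof.
move=> n2; exists act0; split.
- move=> v; apply/rowP => j; rewrite mxE (@int_preimE id id) //.
  by rewrite hat_window ?dot_evec //=; have := ltn_ord j; lia.
- move=> w w' v /affine_group_mirrored mw /affine_group_mirrored mw'.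
  apply/rowP => j; rewrite !mxE hat_act0 //.
  have [[u wK uK] _ _] := mw; have [[u' wK' uK'] _ _] := mw'.
  rewrite (int_preimE wK uK) (int_preimE wK' uK') (@int_preimE _ (u' \o u)) //.
  + by move=> z /=; rewrite wK wK'.
  + by move=> z /=; rewrite uK' uK.
move=> i v hi; apply/rowP => j.
have gK := genK t n2 hi.
rewrite !mxE (int_preimE gK gK).
have hj : (1 <= j.+1 <= n)%N by have := ltn_ord j; lia.
rewrite /gen mirror_ext_window // /gen_reflection /gen_window.
have hneg k : (1 <= k <= n)%N -> hat v (- k%:Z) = 1 - dot v (evec R n k).
  by move=> hk; rewrite hatN hat_window.
have hrefl k : (1 <= k <= n)%N -> hat v (- k%:Z + period n) = - dot v (evec R n k).
  by move=> hk; rewrite hatD hneg //; ring.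
have vE : v 0 j = dot v (evec R n j.+1) by rewrite dot_evec.
have b1 : (1 <= 1 <= n)%N by lia.
have b2 : (1 <= 2 <= n)%N by lia.
have bn : (1 <= n <= n)%N by lia.
have bn1 : (1 <= n.-1 <= n)%N by lia.
have neqn : (n.-1 == n) = false by lia.
have neqn' : (n == n.-1) = false by lia.
have dd a b : (1 <= a <= n)%N -> (1 <= b <= n)%N -> (a == b) = false ->
    dot (evec R n a + evec R n b) (evec R n a + evec R n b) = 2.
  move=> ha hb ab; rewrite !dotDr !dotDl !dot_evec2 //.
  by rewrite [b == a]eq_sym ab !eqxx addr0 add0r.
have d2 a : (1 <= a <= n)%N -> dot (2 *: evec R n a) (2 *: evec R n a) = 4.
  by move=> ha; rewrite dotZr dotC dotZr dot_evec2 // eqxx mulr1; ring.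
case: ifP => i0.
  rewrite /affine_root; case: (t); rewrite ?d2 ?dd // ?dotZr ?dotDr !mxE vE;
    move: (j.+1) hj => k hk; rewrite /s0C /s0D; repeat (case: eqVneq => [?|?]; try (exfalso; lia)); subst;
    rewrite ?hneg ?hat_window //= ?(mulr0n, mulr1n); (try by field).
case: ifP => hin.
  rewrite /simple_root hin.
  have bi : (1 <= i <= n)%N by lia.
  have bi1 : (1 <= i.+1 <= n)%N by lia.
  have nii : (i == i.+1) = false by lia.
  have -> : dot (evec R n i - evec R n i.+1) (evec R n i - evec R n i.+1) = 2.
    rewrite !(dotDr, dotNr, dotDl, dotNl) !dot_evec2 //.
    by rewrite [i.+1 == i]eq_sym nii !eqxx ?(mulr0n, mulr1n) /=; ring.
  rewrite !(dotDr, dotNr) !mxE vE; move: (j.+1) hj => k hk; rewrite /s_mid.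
  have -> : i%:Z + 1 = i.+1%:Z by lia.
  repeat case: eqVneq => [?|?]; subst; rewrite ?hat_window //= ?(mulr0n, mulr1n); try lia; by field.
have {i0 hin hi gK} -> : i = n by lia.
rewrite /simple_root ltnn.
have sn1 : n%:Z + 1 = - n%:Z + period n by rewrite /period; lia.
have sn2 : n%:Z + 2 = - (n.-1)%:Z + period n by rewrite /period; lia.
case: (t); rewrite ?d2 ?dd ?dot_evec2 // ?dotZr ?dotDr !mxE vE ?eqxx;
  move: (j.+1) hj => k hk; rewrite /snC /snD ?sn1 ?sn2;
  repeat (case: eqVneq => [?|?]; try (exfalso; lia)); subst;
  rewrite ?hrefl ?hat_window //= ?(mulr0n, mulr1n); (try by field).
Qed.
End ActionExists.

(* Main.v *)
Require Import Defs.
From mathcomp Require Import all_boot all_order all_algebra.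
From mathcomp Require Import boolp classical_sets functions cardinality reals.
From mathcomp Require Import zify ring lra.

Set Implicit Arguments.
Unset Strict Implicit.
Unset Printing Implicit Defensive.

Import Order.TTheory GRing.Theory Num.Theory.

Local Open Scope ring_scope.

                                           

(** Write N for [period n]. A point v of V is encoded by the function [hat v] on the integers, and
    [act0] composes this function with the inverse permutation. At an integer z that is not a
    multiple of N, [hat 0] is minus the floor of z / N; so the i-th coordinate of the image of the
    origin is minus the floor of w^-1(i) / N. The abacus shows the same number: if the lowest bead
    of runner i is mN + i = w(k) with 1 <= k <= 2n, then w^-1(i) = -mN + k ([act0_origin],
    [level_abacus]). Every geometric action agrees with [act0] on the group, because the generators
    generate it: removing a descent lowers the sum of squared displacements, and only the identity
    has no descent ([affine_group_generated], [act_word]).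

    The parity conditions become conditions on window sums: the number of integers that w carries
    across the cut after c, for c = 0 or c = n, is the sum over the window of the absolute values of
    w(j) / N, suitably rounded ([card_crossings]). At c = 0 this number is the same for w and w^-1,
    whence the even sum of levels in types [BB] and [DD].

    For injectivity, the exchange condition ([word_deletion]) shows that minimal representatives
    have ascents at 1, ..., n. In types [CC] and [BB] they therefore increase on 1, ..., 2n; two of
    them with the same image of the origin differ by a permutation of this block, which monotonicity
    forces to be the identity. In types [BD] and [DD] the same works up to s_n^C, which fixes the
    origin but flips the parity at n ([min_coset_reps_inj]). For surjectivity, translations reach
    every lattice point, corrected by s_n^C in type [BD] when the parity at n is wrong
    ([lattice_point_act0]); passing to a minimal representative keeps the point, since W fixes the
    origin. *)

Lemma period_centered (n : nat) (z : int) : exists m : int, exists2 j : nat,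
  (j <= n)%N & z = m * period n + j%:Z \/ z = m * period n - j%:Z.
Proof.
have [m [r [hr ->]]] := intN_split n z.
have [rn|rn] := leqP r n; first by exists m, r => //; left.
exists (m + 1), (2 * n + 1 - r)%N; first lia.
by right; rewrite mulrDl mul1r /period; lia.
Qed.

Lemma period_inj (n : nat) (m m' x x' : int) :
  `|x - x'| < period n -> m * period n + x = m' * period n + x' ->
  m = m' /\ x = x'.
Proof.
move=> hx h; have : (m - m') * period n = x' - x by rewrite mulrBl; lia.
have [->|ne] := eqVneq m m'; first by lia.
have : m <= m' - 1 \/ m >= m' + 1 by lia.
by move: hx; rewrite /period; case=> ? ?; nia.
Qed.

(** * Mirrored permutations *)

Section Mirrored.
Variables (n : nat) (w : int -> int).
Hypothesis mw : mirrored n w.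

Lemma mirrored_inj : injective w.
Proof. by have [/bij_inj] := mw. Qed.

Lemma mirroredN i : w (- i) = - w i.
Proof. by have [] := mw. Qed.

Lemma mirroredB m i : w (m * period n - i) = m * period n - w i.
Proof. by rewrite (mirroredM m (- i) mw) mirroredN. Qed.

Lemma mirrored_multiple m : w (m * period n) = m * period n.
Proof. by have := mirroredM m 0 mw; rewrite (mirrored0 mw) !addr0. Qed.

Lemma mirrored_nonmultiple (j : nat) m : (1 <= j <= n)%N -> w j%:Z != m * period n.
Proof.
move=> hj; apply/eqP; rewrite -mirrored_multiple => /mirrored_inj h.
have [] : 0 = m /\ j%:Z = 0 by apply: (@period_inj n); [rewrite /period|]; lia.
lia.
Qed.

Lemma mirrored_canV v : cancel w v -> cancel v w.
Proof. by have [[v' _ v'K] _ _] := mw; move=> wK x; rewrite -[x]v'K wK. Qed.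

Lemma mirrored_can v : cancel w v -> mirrored n v.
Proof.
move=> wK; have [_ wD wN] := mw; have vK := mirrored_canV wK.
split; first by exists w.
- by move=> i; apply: mirrored_inj; rewrite wD !vK.
- by move=> i; apply: mirrored_inj; rewrite wN !vK.
Qed.

Lemma mirrored_comp w' : mirrored n w' -> mirrored n (w \o w').
Proof.
move=> [bw' w'D w'N]; have [bw wD wN] := mw; split; first exact: bij_comp.
- by move=> i; rewrite /= w'D wD.
- by move=> i; rewrite /= w'N wN.
Qed.

End Mirrored.

Lemma mirrored_ext (n : nat) w w' : mirrored n w -> mirrored n w' ->
  (forall j : nat, (1 <= j <= n)%N -> w j%:Z = w' j%:Z) -> w = w'.
Proof.
move=> [_ wD wN] [_ w'D w'N] h; apply/funext.
by apply: (@window_eq int n (period n) 0) => // i; rewrite sub0r.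
Qed.

Lemma mirrored_id (n : nat) : mirrored n id.
Proof. by split => //; exists id. Qed.

Lemma mirrored_inverse (n : nat) w : mirrored n w ->
  exists v, [/\ cancel w v, cancel v w & mirrored n v].
Proof.
move=> mw; have [[v wK vK] _ _] := mw; exists v; split => //.
exact: (mirrored_can mw wK).
Qed.

Lemma gen_windowE t n i (j : nat) : (1 <= j <= n)%N ->
  gen t n i j%:Z = gen_window t n i j.
Proof. exact: mirror_ext_window. Qed.

                                                                             
                  
(** * Rounding to multiples of the period *)

(** For [c = 0] this is the floor of x / N, for [c = n] the integer nearest to x / N. These are the
    two roundings adapted to the cuts after 0 and after n, where the parity conditions are
    imposed. *)
Definition rounded (n c : nat) (x : int) : int := ((x + c%:Z) %/ period n)%Z.

Lemma roundedE (n c : nat) (m r : int) : 0 <= r + c%:Z < period n ->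
  rounded n c (m * period n + r) = m.
Proof.
move=> hr; rewrite /rounded -addrA divzMDl; last by rewrite /period; lia.
by rewrite divz_small ?addr0 // ger0_norm //; lia.
Qed.

Lemma rounded_split (n c : nat) (x : int) :
  exists2 r, x = rounded n c x * period n + r & 0 <= r + c%:Z < period n.
Proof.
have P0 : period n != 0 by rewrite /period; lia.
exists (((x + c%:Z) %% period n)%Z - c%:Z).
  by rewrite addrA -divz_eq addrK.
rewrite subrK modz_ge0 //=; have := ltz_mod (x + c%:Z) P0.
by rewrite /period; lia.
Qed.

Lemma roundedD (n c : nat) (x m : int) :
  rounded n c (m * period n + x) = m + rounded n c x.
Proof.
have [r {1}-> hr] := rounded_split n c x.
by rewrite addrA -mulrDl roundedE.
Qed.

Lemma roundedN0 (n : nat) (x : int) : (forall m, x != m * period n) ->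
  rounded n 0 (- x) = - 1 - rounded n 0 x.
Proof.
move=> hx; have [r e hr] := rounded_split n 0 x.
have r0 : r != 0 by apply/eqP=> r0; have /eqP := hx (rounded n 0 x); lia.
move: (rounded n 0 x) e hr r0 => q -> hr r0.
rewrite (_ : - (q * _ + r) = (- 1 - q) * period n + (period n - r)); last by ring.
by rewrite roundedE //; lia.
Qed.

(** The period is odd, so rounding to the nearest multiple meets no ties and is an odd function. *)
Lemma roundedNn (n : nat) (x : int) : rounded n n (- x) = - rounded n n x.
Proof.
have [r e hr] := rounded_split n n x.
rewrite {1}e opprD -mulNr roundedE //; move: hr; rewrite /period; lia.
Qed.

                           

(** * Counting the integers carried across a cut *)

Section Crossings.
Local Open Scope classical_set_scope.

Lemma card_eq_sum_tagged (I : finType) (k : I -> nat) (T : Type) (A : set T)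
    (f : I -> nat -> T) :
  (forall i l, (l < k i)%N -> A (f i l)) ->
  (forall x, A x -> exists i, exists2 l, (l < k i)%N & x = f i l) ->
  (forall i i' l l', (l < k i)%N -> (l' < k i')%N -> f i l = f i' l' ->
     i = i' /\ l = l') ->
  (A #= `I_(\sum_i k i)%N)%card.
Proof.
move=> fA Af finj.
pose S : finType := {i : I & 'I_(k i)}.
have -> : A = [set f (tag s) (tagged s) | s in [set: S]].
  apply/seteqP; split=> [x /Af[i [l hl ->]]|x [[i l] _ <-]]; last exact: fA.
  by exists (Tagged (fun i => 'I_(k i)) (Ordinal hl)).
have -> : `I_(\sum_i k i)%N = [set val (enum_rank s) | s in [set: S]].
  have cS : #|S| = (\sum_i k i)%N.
    by rewrite card_tagged sumnE big_map big_enum; apply: eq_bigr => i _; rewrite card_ord.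
  apply/seteqP; split=> [x /=|x [s _ <-]] /=; rewrite -cS // => hx.
  by exists (enum_val (Ordinal hx)) => //; rewrite enum_valK.
have /card_eql -> : ([set f (tag s) (tagged s) | s in [set: S]] #= [set: S])%card.
  apply: inj_card_eq => -[i l] [i' l'] _ _ /= /finj[] // e; subst i'.
  by move=> /val_inj ->.
rewrite card_eq_sym; apply: inj_card_eq => s s' _ _ /val_inj; exact: enum_rank_inj.
Qed.

Lemma even_cardP (A : set int) k : (A #= `I_k)%card -> even_card A <-> ~~ odd k.
Proof.
move=> hk; split=> [[k' ok' hk']|ok]; last by exists k.
by have /card_eq_II -> : (`I_k #= `I_k')%card by rewrite -(card_eql hk).
Qed.

Definition crossings (c : nat) (w : int -> int) : set int :=
  [set i | i <= c%:Z /\ c%:Z + 1 <= w i].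

Definition window_sum (n c : nat) (w : int -> int) : nat :=
  (\sum_(j < n) `|rounded n c (w j.+1%:Z)|)%N.

(** The non-multiples of N split into the orbits of 1, ..., n under translation by N and negation.
    If [w j] rounds to q, then among the orbit of j only translates of j cross the cut when q >= 0,
    only translates of -j when q < 0, and in both cases exactly |q| of them. *)
Lemma card_crossings (n c : nat) w : mirrored n w -> c = 0%N \/ c = n ->
  (crossings c w #= `I_(window_sum n c w))%card.
Proof.
move=> mw hc; pose q (j : 'I_n) := rounded n c (w j.+1%:Z).
(* For [c = 0] the index j lies above the cut and must be moved down by one period before it can
   cross; for [c = n] it already lies below. *)
have [d hd] : exists d : int, (c = 0%N /\ d = 1) \/ (c = n /\ d = 0).
  by case: hc; [exists 1; left|exists 0; right].
pose f (j : 'I_n) (l : nat) : int :=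
  if 0 <= q j then (- l%:Z - d) * period n + j.+1%:Z
  else (- l%:Z) * period n - j.+1%:Z.
have qP (j : 'I_n) : exists2 r, w j.+1%:Z = q j * period n + r &
    - c%:Z <= r < period n - c%:Z /\ (c = 0%N -> r != 0).
  have [r e hr] := rounded_split n c (w j.+1%:Z); exists r => //; split; first lia.
  move=> _; apply/eqP => r0; have := @mirrored_nonmultiple n w mw j.+1 (q j).
  by rewrite {1}e r0 addr0 eqxx => /(_ _); have := ltn_ord j; lia.
have P0 : 0 < period n by rewrite /period; lia.
have P1 : period n = 2 * n%:Z + 1 by rewrite /period; lia.
apply: (@card_eq_sum_tagged _ _ _ _ f).
- move=> j l; rewrite -/(q j) /crossings /f /= => hl.
  have [r e [hr r0]] := qP j; have hj := ltn_ord j.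
  case: ifP => hq; rewrite ?(mirroredB mw) ?(mirroredM _ _ mw) // e; split.
  + by case: hd => -[c0 d0]; nia.
  + have : 0 <= (- l%:Z - d + q j - (1 - d)) * period n by apply: mulr_ge0; lia.
    by case: hd => -[c0 d0]; nia.
  + nia.
  + have : 0 <= (- l%:Z - q j - 1) * period n by apply: mulr_ge0; lia.
    by nia.
- move=> x [xc wx]; have [m [[|j] hj hx]] := period_centered n x.
    (* Multiples of the period are fixed, so they never cross. *)
    have wE : w x = x.
      by have -> : x = m * period n by [lia]; rewrite (mirrored_multiple mw).
    by lia.
  exists (Ordinal hj); have [r e [hr r0]] := qP (Ordinal hj).
  rewrite -/(q _) /f; move: e => /=; set Q := q _ => e.
  case: hx => hx; move: wx; rewrite {1}hx ?(mirroredB mw) ?(mirroredM _ _ mw) // e => wx.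
    have m0 : m <= - d by case: hd => -[c0 d0]; nia.
    have mq : 1 - d <= m + Q by case: hd => -[c0 d0]; nia.
    have Q0 : 0 <= Q by lia.
    exists (absz (m + d)); first lia.
    by rewrite Q0 hx; congr (_ * _ + _); lia.
  have m0 : m <= 0 by nia.
  have mq : 1 <= m - Q by nia.
  exists `|m|%N; first lia.
  by rewrite ifF ?hx; [congr (_ * _ - _); lia|lia].
move=> i i' l l'; rewrite /f => _ _.
have hi := ltn_ord i; have hi' := ltn_ord i'.
case: ifP => h1; case: ifP => h2 /period_inj[]; try lia.
- by move=> h3 h4; split; [apply: ord_inj|]; lia.
- by move=> h3 h4; split; [apply: ord_inj|]; lia.
Qed.

Lemma even_crossingsP (n c : nat) w : mirrored n w -> c = 0%N \/ c = n ->
  even_card (crossings c w) <-> ~~ odd (window_sum n c w).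
Proof. by move=> mw hc; apply/even_cardP/card_crossings. Qed.

Lemma even_at_0P (n : nat) w : mirrored n w ->
  even_at_0 w <-> ~~ odd (window_sum n 0 w).
Proof. by move=> mw; apply: even_crossingsP => //; left. Qed.

Lemma even_at_nP (n : nat) w : mirrored n w ->
  even_at_n n w <-> ~~ odd (window_sum n n w).
Proof. by move=> mw; apply: even_crossingsP => //; right. Qed.

                                                                                  
(** The map sending i to -w(i) is a bijection between the crossings of 0 by w and those by its
    inverse. It is needed because membership in the group constrains w, whereas the levels read
    w^-1. *)
Lemma window_sum0_inverse (n : nat) w v : mirrored n w -> cancel w v ->
  window_sum n 0 w = window_sum n 0 v.
Proof.
move=> mw wK; have mv := mirrored_can mw wK.
have vK := mirrored_canV mw wK.
apply/card_eq_II; rewrite -(card_eql (card_crossings mw _)); last by left.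
rewrite -(card_eqr (card_crossings mv _)); last by left.
have -> : crossings 0 v = [set - w i | i in crossings 0 w].
  apply/seteqP; split=> [z [z0 vz]|_ [i [i0 wi] <-]].
    exists (v (- z)); last by rewrite vK opprK.
    rewrite /crossings /= vK (mirroredN mv); split; first lia.
    suff : z != 0 by lia.
    by apply/eqP => e; move: vz; rewrite e (mirrored0 mv).
  rewrite /crossings /= (mirroredN mv) wK; split; first lia.
  suff : i != 0 by lia.
  by apply/eqP => e; move: wi; rewrite e (mirrored0 mw).
rewrite card_eq_sym; apply: inj_card_eq => i j _ _ /oppr_inj; exact: (mirrored_inj mw).
Qed.

End Crossings.

                                                         

(** * Effect of a generator on the parities *)

Section SumUpdate.
Variables (n : nat) (F G : nat -> nat).

(** The change of a sum at one index, with the terms moved across so that no truncated subtraction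
    occurs. *)
Lemma sum_update1 p : (1 <= p <= n)%N ->
  (forall j, (1 <= j <= n)%N -> j != p -> F j = G j) ->
  (\sum_(j < n) F j.+1 + G p = \sum_(j < n) G j.+1 + F p)%N.
Proof.
case: p => // p hp FG.
rewrite (bigD1 (Ordinal hp)) // [in RHS](bigD1 (Ordinal hp)) //=.
rewrite (eq_bigr (fun j : 'I_n => G j.+1)) => [|j jp]; first lia.
by apply: FG => //; rewrite ltn_ord.
Qed.

Lemma sum_update2 p q : (1 <= p <= n)%N -> (1 <= q <= n)%N -> p != q ->
  (forall j, (1 <= j <= n)%N -> j != p -> j != q -> F j = G j) ->
  (\sum_(j < n) F j.+1 + G p + G q = \sum_(j < n) G j.+1 + F p + F q)%N.
Proof.
case: p q => // p [//|q] hp hq pq FG.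
have qp : Ordinal hq != Ordinal hp by rewrite -val_eqE /= eq_sym.
rewrite (bigD1 (Ordinal hp)) // [in RHS](bigD1 (Ordinal hp)) //=.
rewrite (bigD1 (Ordinal hq)) // [in RHS](bigD1 (Ordinal hq)) //=.
rewrite (eq_bigr (fun j : 'I_n => G j.+1)) => [|j /andP[jp jq]]; first lia.
by apply: FG => //; rewrite ltn_ord.
Qed.

End SumUpdate.

Lemma odd_sum_update1 (n : nat) (h : int -> nat) (f : nat -> int) p b :
  (1 <= p <= n)%N -> (forall j, (1 <= j <= n)%N -> j != p -> f j = j%:Z) ->
  odd (h (f p)) = odd (h p%:Z) (+) b ->
  odd (\sum_(j < n) h (f j.+1)) = odd (\sum_(j < n) h j.+1%:Z) (+) b.
Proof.
move=> hp fE e; have H := @sum_update1 n (h \o f) (fun j => h j%:Z) p hp.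
have {H} /(congr1 odd) /= : _ := H (fun j hj jp => congr1 h (fE j hj jp)).
by rewrite !oddD e; do 3 case: odd; case: b {e}.
Qed.

Lemma odd_sum_update2 (n : nat) (h : int -> nat) (f : nat -> int) p q b :
  (1 <= p <= n)%N -> (1 <= q <= n)%N -> p != q ->
  (forall j, (1 <= j <= n)%N -> j != p -> j != q -> f j = j%:Z) ->
  odd (h (f p) + h (f q)) = odd (h p%:Z + h q%:Z) (+) b ->
  odd (\sum_(j < n) h (f j.+1)) = odd (\sum_(j < n) h j.+1%:Z) (+) b.
Proof.
move=> hp hq pq fE e; have H := @sum_update2 n (h \o f) (fun j => h j%:Z) p q hp hq pq.
have {H} /(congr1 odd) /= : _ := H (fun j hj jp jq => congr1 h (fE j hj jp jq)).
by rewrite -!addnA oddD [in RHS]oddD e oddD; do 4 case: odd; case: b {e}.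
Qed.

Lemma window_sum_single (n c p : nat) w : (1 <= p <= n)%N ->
  (forall j, (1 <= j <= n)%N -> j != p -> rounded n c (w j%:Z) = 0) ->
  window_sum n c w = absz (rounded n c (w p%:Z)).
Proof.
case: p => // p hp h; rewrite /window_sum (bigD1 (Ordinal hp)) //= big1 ?addn0 //.
by move=> j jp; rewrite h // ltn_ord.
Qed.

Lemma rounded_mirror (n c j : nat) w : mirrored n w -> c = 0%N \/ c = n ->
  (1 <= j <= n)%N ->
  rounded n c (w (- j%:Z)) = - (c == 0%N)%:Z - rounded n c (w j%:Z).
Proof.
move=> mw hc hj; rewrite (mirroredN mw); case: hc => ->.
  by rewrite roundedN0 // => m; apply: mirrored_nonmultiple.
rewrite roundedNn; have -> : (n == 0%N) = false by lia.
by rewrite oppr0 sub0r.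
Qed.

Lemma rounded_mirrorD (n c j : nat) w (z : int) : mirrored n w -> c = 0%N \/ c = n ->
  (1 <= j <= n)%N -> z = period n - j%:Z ->
  rounded n c (w z) = (c != 0%N)%:Z - rounded n c (w j%:Z).
Proof.
move=> mw hc hj ->; rewrite -[period n]mul1r mirroredM // roundedD rounded_mirror //.
by case: eqP => _ /=; lia.
Qed.

(** Sorts the generators of the four types by shape, leaving five cases instead of twelve. *)
Inductive gen_window_spec (t : quotient_type) (n : nat) : nat -> (nat -> int) -> Prop :=
  | GenMid i of (1 <= i < n)%N : gen_window_spec t n i (s_mid i)
  | Gen0C of t = CC \/ t = BD : gen_window_spec t n 0 s0C
  | Gen0D of t = BB \/ t = DD & (3 <= n)%N : gen_window_spec t n 0 s0D
  | GenNC of t = CC \/ t = BB : gen_window_spec t n n (snC n)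
  | GenND of t = BD \/ t = DD & (3 <= n)%N : gen_window_spec t n n (snD n).

Lemma min_rank_ge2 t n : (min_rank t <= n)%N -> (2 <= n)%N.
Proof. by case: t => /=; lia. Qed.

Lemma gen_windowP t n i : (min_rank t <= n)%N -> (i <= n)%N ->
  gen_window_spec t n i (gen_window t n i).
Proof.
move=> hn hi; rewrite /gen_window; case: eqP => [->|/eqP i0].
  by case: t hn => hn; constructor => //; try (by [left|right]); move: hn => /=; lia.
case: ltnP => [lin|nin]; first by constructor; lia.
have -> : i = n by lia.
by case: t hn => hn; constructor => //; try (by [left|right]); move: hn => /=; lia.
Qed.

(** At index 1, [s0C] turns a floor q into -1 - q, which changes its parity, and a nearest rounding
    q into -q, which does not. At index n, [snC] turns q into -q and 1 - q respectively. [s0D] and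
    [snD] do this at two indices at once, so the parity changes cancel. *)
Lemma window_sum_gen (t : quotient_type) (n c i : nat) w :
  (min_rank t <= n)%N -> (i <= n)%N -> mirrored n w -> c = 0%N \/ c = n ->
  odd (window_sum n c (w \o gen t n i)) = odd (window_sum n c w) (+)
    match t with
    | CC => (i == c) && ((i == 0) || (i == n))
    | BB => (i == n) && (c == n)
    | BD => (i == 0) && (c == 0)
    | DD => false
    end%N.
Proof.
move=> hn hi mw hc; have n2 := min_rank_ge2 hn.
have wsE : window_sum n c (w \o gen t n i) =
    (\sum_(j < n) `|rounded n c (w (gen_window t n i j.+1))|)%N.
  by apply: eq_bigr => j _; rewrite /= gen_windowE //; have := ltn_ord j; lia.
rewrite wsE /window_sum {wsE}; pose h z := absz (rounded n c (w z)).
have b1 : (1 <= 1 <= n)%N by lia.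
have b2 : (1 <= 2 <= n)%N by lia.
have bn : (1 <= n <= n)%N by lia.
have bn1 : (1 <= n.-1 <= n)%N by lia.
have negE j : (1 <= j <= n)%N -> rounded n c (w (- j%:Z)) =
  - (c == 0%N)%:Z - rounded n c (w j%:Z) by exact: rounded_mirror.
have refE j z : (1 <= j <= n)%N -> z = period n - j%:Z -> rounded n c (w z) =
  (c != 0%N)%:Z - rounded n c (w j%:Z) by exact: rounded_mirrorD.
case: {i hi} (gen_window t n i) / (gen_windowP hn hi) => [i hi|ht|ht n3|ht|ht n3].
- apply: (@odd_sum_update2 n h _ i i.+1); try lia.
    by move=> j hj ? ?; rewrite /s_mid !ifN.
  have -> : s_mid i i = i.+1%:Z by rewrite /s_mid eqxx; lia.
  have -> : s_mid i i.+1 = i%:Z by rewrite /s_mid eqxx ifN //; lia.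
  by rewrite addnC -[LHS]addbF; congr (_ (+) _); case: (t); lia.
- apply: (@odd_sum_update1 n h _ 1) => //.
    by move=> j hj ?; rewrite /s0C ifN.
  rewrite /h /s0C /= negE //.
  by case: ht => ->; case: hc => hc; rewrite hc ?eqxx /=; lia.
- apply: (@odd_sum_update2 n h _ 1 2) => //.
    by move=> j hj ? ?; rewrite /s0D !ifN.
  rewrite /h /s0D /= (negE 1%N) // (negE 2%N) //; case: ht => ->; lia.
- apply: (@odd_sum_update1 n h _ n) => //.
    by move=> j hj ?; rewrite /snC ifN.
  rewrite /h /snC eqxx (refE n (n%:Z + 1) bn); last by rewrite /period; lia.
  case: ht => ->; lia.
- apply: (@odd_sum_update2 n h _ n.-1 n) => //; try lia.
    by move=> j hj ? ?; rewrite /snD !ifN.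
  have nn : (n == n.-1) = false by lia.
  rewrite /h /snD eqxx nn eqxx (refE n (n%:Z + 1)) //; last by rewrite /period; lia.
  rewrite (refE n.-1 (n%:Z + 2)) //; last by rewrite /period; lia.
  case: ht => ->; lia.
Qed.

                               

(** * Descents and generation of the affine group *)

Lemma affine_groupP t n w : affine_group t n w <->
  [/\ mirrored n w, match t with BB | DD => ~~ odd (window_sum n 0 w) | _ => True end
    & match t with BD | DD => ~~ odd (window_sum n n w) | _ => True end].
Proof.
case: t => /=; split.
- by move=> mw.
- by case.
- by move=> [mw /(even_at_0P mw)].
- by move=> [mw /(even_at_0P mw)].
- by move=> [mw /(even_at_nP mw)].
- by move=> [mw _ /(even_at_nP mw)].
- by move=> [mw /(even_at_0P mw) ? /(even_at_nP mw)].
- by move=> [mw /(even_at_0P mw) ? /(even_at_nP mw)].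
Qed.

Section Generation.
Variables (t : quotient_type) (n : nat).
Hypothesis hn : (min_rank t <= n)%N.

Lemma affine_group_comp_gen (i : nat) w : (i <= n)%N ->
  affine_group t n w -> affine_group t n (w \o gen t n i).
Proof.
move=> hi /affine_groupP[mw e0 en]; have n2 := min_rank_ge2 hn.
have n0 : (0 == n)%N = false by lia.
apply/affine_groupP; split.
- by apply: mirrored_comp => //; apply: gen_mirrored => //; apply: min_rank_ge2 hn.
- move: hn e0; case E: t => // h; rewrite -E window_sum_gen ?E //; try by left.
    by rewrite n0 andbF addbF.
  by rewrite addbF.
- move: hn en; case E: t => // h; rewrite -E window_sum_gen ?E //; try by right.
    by rewrite (eqn0Ngt n) ltnW // andbF addbF.
  by rewrite addbF.
Qed.

Lemma affine_group_id : affine_group t n id.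
Proof.
have ws0 c : c = 0%N \/ c = n -> window_sum n c id = 0%N.
  move=> hc; apply: big1 => j _; have hj := ltn_ord j.
  rewrite /= -[j.+1%:Z]add0r -[0](mul0r (period n)) roundedE //.
  by rewrite /period; lia.
by apply/affine_groupP; rewrite !ws0; [|by right|by left]; split; try case: (t) => //; exact: mirrored_id.
Qed.

Lemma word_prod_cat (s s' : seq 'I_n.+1) :
  word_prod t (s ++ s') = word_prod t s \o word_prod t s'.
Proof. by elim: s => //= i s ->. Qed.

Lemma word_prod_rcons (s : seq 'I_n.+1) (i : 'I_n.+1) :
  word_prod t (rcons s i) = word_prod t s \o gen t n i.
Proof. by rewrite -cats1 word_prod_cat. Qed.

Lemma affine_group_word (s : seq 'I_n.+1) : affine_group t n (word_prod t s).
Proof.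
elim/last_ind: s => [|s i ih]; first exact: affine_group_id.
by rewrite word_prod_rcons; apply: affine_group_comp_gen => //; rewrite -ltnS.
Qed.

                                                                  
                                      
(** The integer below [i + 1] that the i-th generator exchanges with [i + 1]. Thus w has a descent
    at i when [w (i + 1) < w (root_source i)]. *)
Definition root_source (i : nat) : int :=
  if i == 0%N then match t with CC | BD => - 1 | BB | DD => - 2 end
  else if (i < n)%N then i%:Z
  else match t with CC | BB => n%:Z | BD | DD => n%:Z - 1 end.

Lemma root_source0C : t = CC \/ t = BD -> root_source 0 = - 1%N%:Z.
Proof. by rewrite /root_source; case=> ->. Qed.

Lemma root_source0D : t = BB \/ t = DD -> root_source 0 = - 2%N%:Z.
Proof. by rewrite /root_source; case=> ->. Qed.

Lemma root_source_mid i : (1 <= i < n)%N -> root_source i = i%:Z.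
Proof. by move=> hi; rewrite /root_source ifN ?ifT //; lia. Qed.

Lemma root_sourcenC : t = CC \/ t = BB -> root_source n = n%:Z.
Proof.
have n2 := min_rank_ge2 hn.
by move=> ht; rewrite /root_source ltnn ifN; [case: ht => ->|lia].
Qed.

Lemma root_sourcenD : t = BD \/ t = DD -> root_source n = n.-1%:Z.
Proof.
have n2 := min_rank_ge2 hn.
by move=> ht; rewrite /root_source ltnn ifN; [case: ht => ->|]; lia.
Qed.

Definition displacement (w : int -> int) : nat :=
  (\sum_(j < n) `|w j.+1%:Z - j.+1%:Z| ^ 2)%N.

(** A rearrangement inequality: the generator moves the larger value to the larger position, which
    lowers the sum of squared displacements. Positions outside the window are brought back by the
    mirror symmetry. *)
Lemma displacement_gen w (i : nat) : mirrored n w -> (i <= n)%N ->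
  w (i%:Z + 1) < w (root_source i) ->
  (displacement (w \o gen t n i) < displacement w)%N.
Proof.
move=> mw hi; have n2 := min_rank_ge2 hn.
pose F j := (absz (w (gen_window t n i j) - j%:Z) ^ 2)%N.
pose G (j : nat) := (absz (w j%:Z - j%:Z) ^ 2)%N.
have dE : displacement (w \o gen t n i) = (\sum_(j < n) F j.+1)%N.
  by apply: eq_bigr => j _; rewrite /= gen_windowE //; have := ltn_ord j; lia.
rewrite dE {dE} [displacement w](_ : _ = \sum_(j < n) G j.+1)%N //.
have b1 : (1 <= 1 <= n)%N by lia.
have b2 : (1 <= 2 <= n)%N by lia.
have bn : (1 <= n <= n)%N by lia.
have bn1 : (1 <= n.-1 <= n)%N by lia.
have sq (x : int) : (absz x ^ 2)%N = absz (x * x) by rewrite abszM.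
have nonneg (x : int) : 0 <= x * x by rewrite -expr2 sqr_ge0.
have refE j z : z = period n - j%:Z -> w z = period n - w j%:Z.
  by move=> ->; rewrite -[period n]mul1r mirroredB.
have PE : period n = 2 * n%:Z + 1 by rewrite /period; lia.
have lt2 (X Y : nat) (a b a' b' : int) : a' * a' + b' * b' < a * a + b * b ->
    (X + absz (a * a)%R + absz (b * b)%R = Y + absz (a' * a')%R + absz (b' * b')%R)%N -> (X < Y)%N.
  by move: (nonneg a) (nonneg b) (nonneg a') (nonneg b'); lia.
have lt1 (X Y : nat) (a a' : int) : a' * a' < a * a ->
    (X + absz (a * a)%R = Y + absz (a' * a')%R)%N -> (X < Y)%N.
  by move: (nonneg a) (nonneg a'); lia.
rewrite /F {F}.
case: {i hi} (gen_window t n i) / (gen_windowP hn hi) => [i hi|ht|ht n3|ht|ht n3].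
- rewrite root_source_mid //.
  have [e1 e2] : s_mid i i = i.+1%:Z /\ s_mid i i.+1 = i%:Z.
    by rewrite /s_mid !eqxx; split; [|rewrite ifN //]; lia.
  have := @sum_update2 n (fun j => absz (w (s_mid i j) - j%:Z) ^ 2)%N G i i.+1.
  rewrite /G e1 e2 !sq => /(_ ltac:(lia) ltac:(lia) ltac:(lia)).
  move=> /(_ ltac:(by move=> j hj ? ?; rewrite /s_mid !ifN)).
  rewrite (_ : i%:Z + 1 = i.+1%:Z); last lia.
  by move=> + hw; apply: lt2; nia.
- rewrite root_source0C //.
  rewrite (mirroredN mw) (_ : 0%N%:Z + 1 = 1%N%:Z) //.
  have := @sum_update1 n (fun j => absz (w (s0C j) - j%:Z) ^ 2)%N G 1%N b1.
  rewrite /G /= (mirroredN mw) !sq.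
  move=> /(_ ltac:(by move=> j hj ?; rewrite /s0C ifN)).
  by move: (w 1%N%:Z) => x + hw; apply: lt1; nia.
- rewrite root_source0D //.
  rewrite (mirroredN mw) (_ : 0%N%:Z + 1 = 1%N%:Z) //.
  have := @sum_update2 n (fun j => absz (w (s0D j) - j%:Z) ^ 2)%N G 1%N 2%N b1 b2 isT.
  rewrite /G /= !(mirroredN mw) !sq.
  move=> /(_ ltac:(by move=> j hj ? ?; rewrite /s0D !ifN)).
  by move: (w 1%N%:Z) (w 2%N%:Z) => x y + hw; apply: lt2; nia.
- rewrite root_sourcenC //.
  have := @sum_update1 n (fun j => absz (w (snC n j) - j%:Z) ^ 2)%N G n bn.
  rewrite /G /snC eqxx (refE n (n%:Z + 1)) ?sq; last by rewrite PE; lia.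
  move=> /(_ ltac:(by move=> j hj ?; rewrite ifN)).
  by rewrite PE => + hw; apply: lt1; nia.
rewrite root_sourcenD //.
have := @sum_update2 n (fun j => absz (w (snD n j) - j%:Z) ^ 2)%N G n.-1 n bn1 bn.
have nn : (n == n.-1) = false by lia.
rewrite /G /snD eqxx nn eqxx (refE n (n%:Z + 1)); last by rewrite PE; lia.
rewrite (refE n.-1 (n%:Z + 2)) ?sq; last by rewrite PE; lia.
move=> /(_ ltac:(by rewrite eq_sym nn) ltac:(by move=> j hj ? ?; rewrite !ifN)).
by rewrite PE => + hw; apply: lt2; nia.
Qed.

(** Without descents the window increases and is squeezed to the identity on 2, ..., n - 1. The
    D-shaped ends would still allow w(1) = -1 or w(n) = n + 1, but either makes a window sum equal
    to 1, against the parity condition. *)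
Lemma no_descent_id w : affine_group t n w ->
  (forall i : nat, (i <= n)%N -> w (root_source i) <= w (i%:Z + 1)) -> w = id.
Proof.
move=> /affine_groupP[mw e0 en] hw; have n2 := min_rank_ge2 hn.
have PE : period n = 2 * n%:Z + 1 by rewrite /period; lia.
have wn1 : w (n%:Z + 1) = period n - w n%:Z.
  by rewrite -[period n]mul1r -(mirroredB mw); congr w; rewrite PE; lia.
have neq (x y : int) : x != y -> w x != w y by rewrite (inj_eq (mirrored_inj mw)).
have up1 i : (1 <= i < n)%N -> w i%:Z < w i.+1%:Z.
  move=> hi; have := hw i ltac:(lia); rewrite /root_source ifN ?ifT; try lia.
  have := neq i%:Z i.+1%:Z; rewrite (_ : i%:Z + 1 = i.+1%:Z); lia.
have up i k : (1 <= i)%N -> (i + k <= n)%N -> w i%:Z + k%:Z <= w (i + k)%N%:Z.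
  move=> hi; elim: k => [|k ih] hk; first by rewrite addn0 addr0.
  have := up1 (i + k)%N; rewrite addnS; lia.
have w1_neq0 : w 1%N%:Z != 0 by have := mirrored_nonmultiple mw 0 (j:=1); rewrite mul0r; apply; lia.
have tC : (t = CC \/ t = BD) \/ (t = BB \/ t = DD) by case: (t); tauto.
have tn : (t = CC \/ t = BB) \/ (t = BD \/ t = DD) by case: (t); tauto.
have n3 : t = BB \/ t = BD \/ t = DD -> (3 <= n)%N.
  by move: hn => /[swap]; case=> [->|[->|->]] /=; lia.
(* The generator at 0 yields the lower bounds; below, the generator at n yields the upper bounds. *)
have [low1 low] : (1 <= w 1%N%:Z \/ (t = BB \/ t = DD) /\ `|w 1%N%:Z| < w 2%N%:Z) /\
    (forall j : nat, (2 <= j <= n)%N -> j%:Z <= w j%:Z).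
  have h0 := hw 0%N isT; have h12 := up1 1%N ltac:(lia).
  case: tC => ht; move: h0; rewrite (_ : 0%N%:Z + 1 = 1%N%:Z) //.
    rewrite root_source0C // (mirroredN mw) => h0; have h1 : 1 <= w 1%N%:Z by lia.
    split; first by left.
    by move=> j hj; have := up 1%N j.-1 isT; rewrite (_ : 1 + j.-1 = j)%N; lia.
  have := neq (- 2%N%:Z) 1%N%:Z isT; rewrite root_source0D // (mirroredN mw) => h2 h0.
  split; first by right; split => //; lia.
  by move=> j hj; have := up 2%N (j - 2)%N isT; rewrite (_ : 2 + (j - 2) = j)%N; lia.
have [highn high] : (w n%:Z <= n%:Z \/ (t = BD \/ t = DD) /\ w n.-1%:Z + w n%:Z < period n) /\
    (forall j : nat, (1 <= j < n)%N -> w j%:Z <= j%:Z).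
  have hn0 := hw n (leqnn n); have hn1 := up1 n.-1 ltac:(lia).
  rewrite (ltn_predK n2) in hn1.
  case: tn => ht; move: hn0; rewrite wn1.
    rewrite root_sourcenC // => h0; have h1 : w n%:Z <= n%:Z by lia.
    split; first by left.
    by move=> j hj; have := up j (n - j)%N; rewrite (_ : j + (n - j) = n)%N; lia.
  have := neq n.-1%:Z (n%:Z + 1) ltac:(lia); rewrite root_sourcenD // wn1 => h2 h0.
  split; first by right; split => //; lia.
  by move=> j hj; have := up j (n.-1 - j)%N; rewrite (_ : j + (n.-1 - j) = n.-1)%N; lia.
have mid (j : nat) : (2 <= j < n)%N -> w j%:Z = j%:Z.
  by move=> hj; have := low j; have := high j; lia.
have small c (x : int) : - c%:Z <= x < period n - c%:Z -> rounded n c x = 0.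
  by move=> hx; rewrite -[x]add0r -[0](mul0r (period n)) roundedE //; lia.
have [w1 wn] : (w 1%N%:Z = 1 \/ w 1%N%:Z = - 1 /\ (t = BB \/ t = DD)) /\
    (w n%:Z = n%:Z \/ w n%:Z = n%:Z + 1 /\ (t = BD \/ t = DD)).
  have high1 := high 1%N ltac:(lia); have lown := low n ltac:(lia); split.
    case: low1 => [|[ht lt12]]; first lia.
    have n3' : (3 <= n)%N by apply: n3; tauto.
    have [|] : w 1%N%:Z = 1 \/ w 1%N%:Z = - 1 by have := high 2%N; lia.
      by left.
    by right.
  case: highn => [|[ht ltn]]; first lia.
  have n3' : (3 <= n)%N by apply: n3; tauto.
  have [|] : w n%:Z = n%:Z \/ w n%:Z = n%:Z + 1 by have := low n.-1; lia.
    by left.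
  by right.
(* The value -1 has floor -1 and all other window values have floor 0, so the sum at the cut 0 would
   be odd. *)
have {}w1 : w 1%N%:Z = 1.
  case: w1 => // -[w1 ht]; exfalso; suff : window_sum n 0 w = 1%N.
    by move=> ws; move: e0; rewrite ws; case: ht => ->.
  rewrite (@window_sum_single n 0 1); [|lia|].
    rewrite w1 (_ : - 1 = (- 1) * period n + (period n - 1)); last by ring.
    by rewrite roundedE //; lia.
  move=> j hj j1; have [->|jn] := eqVneq j n; last by rewrite mid ?small //; lia.
  by apply: small; case: wn => [->|[-> _]]; lia.
have {}wn : w n%:Z = n%:Z.
  case: wn => // -[wn ht]; exfalso; suff : window_sum n n w = 1%N.
    by move=> ws; move: en; rewrite ws; case: ht => ->.
  rewrite (@window_sum_single n n n); [|lia|].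
    rewrite wn (_ : n%:Z + 1 = 1 * period n - n%:Z); last lia.
    by rewrite roundedE //; lia.
  move=> j hj jn; have [->|j1] := eqVneq j 1%N; last by rewrite mid ?small //; lia.
  by rewrite w1 small //; lia.
apply: mirrored_ext mw (mirrored_id n) _ => j hj.
have [->|j1] := eqVneq j 1%N; first by rewrite w1.
have [->|jn] := eqVneq j n; first by rewrite wn.
by rewrite mid; lia.
Qed.

Lemma affine_group_generated w :
  affine_group t n w -> exists s : seq 'I_n.+1, w = word_prod t s.
Proof.
have [k] := ubnP (displacement w); elim: k w => // k ih w hk aw.
have mw := affine_group_mirrored aw; have n2 := min_rank_ge2 hn.
have [[i hi lt_i]|none] :=
    EM (exists2 i : nat, (i <= n)%N & w (i%:Z + 1) < w (root_source i)).
  have hd := displacement_gen mw hi lt_i.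
  have [|s es] := ih (w \o gen t n i) _ (affine_group_comp_gen hi aw).
    exact: leq_trans hd _.
  exists (rcons s (Ordinal (hi : (i < n.+1)%N))).
  by rewrite word_prod_rcons -es; apply/funext => z /=; rewrite genK.
exists [::]; apply: no_descent_id => // i hi.
by rewrite leNgt; apply/negP => lt_i; apply: none; exists i.
Qed.

(** [a] and [c] lie in one orbit under translation by the period and negation; a mirrored
    permutation is determined on an orbit by one of its values. *)
Definition congruent (a c : int) : Prop :=
  exists m : int, c = m * period n + a \/ c = m * period n - a.

Lemma gen_reversal (k : nat) a b : (k <= n)%N ->
  ~ congruent 0 a -> ~ congruent 0 b -> (forall m, b <> m * period n + a) ->
  ~ congruent a b \/ (a + b = period n /\ (t = CC \/ t = BB)) ->
  a < b -> gen t n k b < gen t n k a ->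
  gen t n k a = b /\
  forall c, ~ congruent a c -> ~ congruent b c -> gen t n k c = c.
Proof.
move=> hk a0 b0 ba1 ba2; have n2 := min_rank_ge2 hn.
have mg := gen_mirrored t n2 hk.
have [m [j hj ha]] := period_centered n a.
have [m' [j' hj' hb]] := period_centered n b.
have j0 : (0 < j)%N by rewrite lt0n; apply/eqP => j0; apply: a0; exists m; left; lia.
have j0' : (0 < j')%N by rewrite lt0n; apply/eqP => j0'; apply: b0; exists m'; left; lia.
have PE : period n = 2 * n%:Z + 1 by rewrite /period; lia.
(* Since b is not a translate of a, equal residues up to sign leave only the exceptional pair. *)
have jj1 : j = j' -> a + b = (m + m') * period n /\ m + m' = 1 /\ (t = CC \/ t = BB).
  move=> e; subst j'.
  have opp : a + b = (m + m') * period n.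
    by case: ha hb => ha [] hb; [case: (ba1 (m' - m))| | |case: (ba1 (m' - m))];
      rewrite ha hb; ring.
  split => //; case: ba2 => [[]|[abN ?]].
    by exists (m + m'); right; lia.
  split => //; move: opp; rewrite abN.
  by rewrite -[LHS]addr0 -[X in X + _]mul1r -[RHS]addr0 => /period_inj []; lia.
suff H : a < b -> gen t n k b < gen t n k a -> gen t n k a = b /\
    forall i, (1 <= i <= n)%N -> i != j -> i != j' -> gen_window t n k i = i.
  move=> ab gba; have [-> fix_i] := H ab gba; split => // c ac bc.
  have [m'' [i hi hc]] := period_centered n c.
  have [i0|i0] := eqVneq i 0%N.
    have -> : c = m'' * period n by lia.
    by rewrite mirrored_multiple.
  have ij : i != j.
    apply/eqP => e; subst i; apply: ac.
    by case: ha hc => -> [] ->;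
      [exists (m'' - m)|exists (m'' + m)|exists (m'' + m)|exists (m'' - m)];
      [left|right|right|left]; ring.
  have ij' : i != j'.
    apply/eqP => e; subst i; apply: bc.
    by case: hb hc => -> [] ->;
      [exists (m'' - m')|exists (m'' + m')|exists (m'' + m')|exists (m'' - m')];
      [left|right|right|left]; ring.
  have gi : gen t n k i%:Z = i%:Z by rewrite gen_windowE ?fix_i //; lia.
  by case: hc => ->; rewrite ?(mirroredB mg) ?(mirroredM _ _ mg) gi.
(* The multiples of the period are compared here once, so that they can be generalized to plain
   variables and the case analysis becomes linear. *)
have cmp : [\/ m' * period n = m * period n,
    m' * period n = m * period n + period n,
    m' * period n >= m * period n + 2 * period n
    | m * period n >= m' * period n + period n].
  have : m = m' \/ m' = m + 1 \/ m' - m - 2 >= 0 \/ m - m' - 1 >= 0 by lia.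
  have P0 : 0 <= period n by lia.
  case=> [->|[->|[h|h]]]; [exact: Or41|apply: Or42; ring|apply: Or43|apply: Or44];
    have := mulr_ge0 h P0; lia.
have gj : gen t n k j%:Z = gen_window t n k j by rewrite gen_windowE //; lia.
have gj' : gen t n k j'%:Z = gen_window t n k j' by rewrite gen_windowE //; lia.
have {}jj1 : j = j' -> a + b = period n /\ ~ (t = BD \/ t = DD).
  by move=> /jj1[-> [-> tE]]; rewrite mul1r; split => //; case: tE => ->; case.
have ea : (a = m * period n + j%:Z /\ gen t n k a = m * period n + gen_window t n k j)
  \/ (a = m * period n - j%:Z /\ gen t n k a = m * period n - gen_window t n k j).
  by rewrite -gj; case: ha => ->; [left; rewrite mirroredM|right; rewrite (mirroredB mg)].
have eb : (b = m' * period n + j'%:Z /\ gen t n k b = m' * period n + gen_window t n k j')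
  \/ (b = m' * period n - j'%:Z /\ gen t n k b = m' * period n - gen_window t n k j').
  by rewrite -gj'; case: hb => ->; [left; rewrite mirroredM|right; rewrite (mirroredB mg)].
clear a0 b0 ba1 ba2 ha hb gj gj' mg.
move: (gen t n k a) (gen t n k b) (m * period n) (m' * period n) ea eb cmp => ga gb M M' ea eb cmp.
have jj2 : j = j' -> a + b = period n by move=> /jj1[].
move: ea eb; case: {k hk} (gen_window t n k) / (gen_windowP hn hk) => [i hi|ht|ht n3|ht|ht n3] ea eb ab gab.
- have [jE ->] : (j = i /\ j' = i.+1 \/ j = i.+1 /\ j' = i) /\ ga = b.
    clear jj1; move: ea eb; rewrite /s_mid.
    by case: cmp => cmp; case: (eqVneq j i) => ?; case: (eqVneq j i.+1) => ?;
      case: (eqVneq j' i) => ?; case: (eqVneq j' i.+1) => ?; lia.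
  by split => // x hx xj xj'; rewrite /s_mid !ifN //; lia.
- have [jE ->] : (j = 1%N /\ j' = 1%N) /\ ga = b.
    clear jj1; move: ea eb; rewrite /s0C.
    by case: cmp => cmp; case: (eqVneq j 1%N) => ?; case: (eqVneq j' 1%N) => ?; lia.
  by split => // x hx xj xj'; rewrite /s0C !ifN //; lia.
- have [jE ->] : (j = 1%N /\ j' = 2%N \/ j = 2%N /\ j' = 1%N) /\ ga = b.
    clear jj1; move: ea eb; rewrite /s0D.
    by case: cmp => cmp; case: (eqVneq j 1%N) => ?; case: (eqVneq j 2%N) => ?;
      case: (eqVneq j' 1%N) => ?; case: (eqVneq j' 2%N) => ?; lia.
  by split => // x hx xj xj'; rewrite /s0D !ifN //; lia.
- have [jE ->] : (j = n /\ j' = n) /\ ga = b.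
    clear jj1; move: ea eb; rewrite /snC.
    by case: cmp => cmp; case: (eqVneq j n) => ?; case: (eqVneq j' n) => ?; lia.
  by split => // x hx xj xj'; rewrite /snC !ifN //; lia.
have jj' : j <> j' by move=> /jj1[_].
have [jE ->] : (j = n.-1 /\ j' = n \/ j = n /\ j' = n.-1) /\ ga = b.
  clear jj1; move: ea eb; rewrite /snD.
  by case: cmp => cmp; case: (eqVneq j n.-1) => ?; case: (eqVneq j n) => ?;
    case: (eqVneq j' n.-1) => ?; case: (eqVneq j' n) => ?; lia.
by split => // x hx xj xj'; rewrite /snD !ifN //; lia.
Qed.

End Generation.

                                                   

(** * Exchange condition and minimal coset representatives *)

Lemma congruent_small (n : nat) (x y : int) : 0 <= x < period n -> 0 < y < period n ->
  congruent n x y -> y = x \/ x + y = period n.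
Proof.
move=> hx hy [m [e|e]]; [left|right].
  have : 0 * period n + y = m * period n + x by rewrite mul0r add0r.
  by move/period_inj => []; lia.
have := @period_inj n 1 m (y - period n) (- x).
rewrite -e => /(_ _ _)[]; lia.
Qed.

Lemma mirrored_congruent (n : nat) u x y : mirrored n u ->
  congruent n (u x) (u y) -> congruent n x y.
Proof.
move=> mu [m [|]].
  by rewrite -(mirroredM _ _ mu) => /(mirrored_inj mu) ->; exists m; left.
by rewrite -(mirroredB mu) => /(mirrored_inj mu) ->; exists m; right.
Qed.

Lemma minimizer_exists (T : Type) (P : T -> Prop) (f : T -> nat) x :
  P x -> exists2 y, P y & forall z, P z -> (f y <= f z)%N.
Proof.
have [k] := ubnP (f x); elim: k x => // k ih x hk Px.
have [[z Pz ltz]|none] := EM (exists2 z, P z & (f z < f x)%N).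
  exact: ih (leq_trans ltz _) Pz.
by exists x => // z Pz; rewrite leqNgt; apply/negP => ltz; apply: none; exists z.
Qed.

Section Length.
Variables (t : quotient_type) (n : nat).
Hypothesis hn : (min_rank t <= n)%N.

(** Let p and q be the integers exchanged by the i-th generator. By [gen_reversal], the k-th
    generator exchanges u(p) with u(q) and fixes the values on all other orbits, so both sides agree
    on the window. *)
Lemma gen_conjugate (k i : nat) u : (k <= n)%N -> (1 <= i <= n)%N -> mirrored n u ->
  u (root_source t n i) < u (i%:Z + 1) ->
  gen t n k (u (i%:Z + 1)) < gen t n k (u (root_source t n i)) ->
  gen t n k \o u = u \o gen t n i.
Proof.
move=> hk hi mu; have n2 := min_rank_ge2 hn.
have PE : period n = 2 * n%:Z + 1 by rewrite /period; lia.
have tn : (t = CC \/ t = BB) \/ (t = BD \/ t = DD) by case: (t); tauto.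
have : [\/ root_source t n i = i%:Z /\ (i < n)%N,
  root_source t n i = n%:Z /\ i = n /\ (t = CC \/ t = BB)
  | root_source t n i = n.-1%:Z /\ i = n /\ (t = BD \/ t = DD)].
  have [lin|nin] := ltnP i n; first by apply: Or31; rewrite root_source_mid //; lia.
  have -> : i = n by lia.
  by case: tn => ht; [apply: Or32; rewrite root_sourcenC|apply: Or33; rewrite root_sourcenD].
set p := root_source t n i; set q := i%:Z + 1 => hp uab gab.
have hpq : [/\ 0 < p, p < q & q <= n%:Z + 1] by rewrite /q; case: hp => -[-> H]; split; lia.
have [p0 pq qn] := hpq.
have u0 z : 0 < z < period n -> ~ congruent n 0 (u z).
  move=> hz; rewrite -{1}(mirrored0 mu) => /(mirrored_congruent mu).
  by move/congruent_small => []; lia.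
have [||m||gE gfix] := gen_reversal hn hk _ _ _ _ uab gab.
- by apply: u0; lia.
- by apply: u0; lia.
- rewrite -(mirroredM _ _ mu) => /(mirrored_inj mu) e.
  have : 0 * period n + q = m * period n + p by rewrite mul0r add0r.
  by move/period_inj => []; lia.
- case: hp => -[pE H].
  + by left=> /(mirrored_congruent mu)/congruent_small[]; rewrite /q; lia.
  + case: H => iE ht; right; split => //.
    rewrite pE (_ : q = 1 * period n - n%:Z) ?(mirroredB mu); first lia.
    by rewrite /q PE; lia.
  + by left=> /(mirrored_congruent mu)/congruent_small[]; rewrite /q; lia.
have gK := genK t n2 hk.
have gE' : gen t n k (u q) = u p by rewrite -gE gK.
have mg := gen_mirrored t n2 hk.
have hin : (i <= n)%N by lia.
apply: (mirrored_ext (mirrored_comp mg mu) (mirrored_comp mu (gen_mirrored t n2 hin))) => j hj /=.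
rewrite gen_windowE //.
have gfixj : j%:Z != p -> j%:Z != q -> j%:Z + q != period n -> gen t n k (u j%:Z) = u j%:Z.
  by move=> jp jq jq'; apply: gfix => /(mirrored_congruent mu)/congruent_small[]; lia.
clear uab gab gfix u0 hpq.
have qE : q = i%:Z + 1 by [].
move: p q qE hp p0 pq qn gE gE' gfixj => p q qE hp p0 pq qn gE gE' gfixj.
case: hp qE => -[pE H] qE.
- have -> : gen_window t n i = s_mid i.
    by rewrite /gen_window ifN ?ifT //; lia.
  rewrite /s_mid; case: (eqVneq j i) => [->|ji].
    by rewrite -{1}pE gE qE.
  case: (eqVneq j i.+1) => [->|ji']; last by apply: gfixj; lia.
  by rewrite (_ : i.+1%:Z = q) ?gE' ?pE //; lia.
- case: H => iE ht; have -> : gen_window t n i = snC n.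
    by rewrite /gen_window ifN ?ifF; [case: ht => ->|lia|lia].
  rewrite /snC; case: (eqVneq j n) => [->|jn]; last by apply: gfixj; lia.
  by rewrite -{1}pE gE qE iE.
case: H => iE ht; have -> : gen_window t n i = snD n.
  by rewrite /gen_window ifN ?ifF; [case: ht => ->|lia|lia].
rewrite /snD; case: (eqVneq j n.-1) => [->|jn1].
  by rewrite -{1}pE gE qE iE.
case: (eqVneq j n) => [->|jn]; last by apply: gfixj; lia.
rewrite [in LHS](_ : n%:Z = 1 * period n - q); last by lia.
rewrite (_ : n%:Z + 2 = 1 * period n - p); last by lia.
by rewrite !(mirroredB mu) (mirroredB mg) gE'.
Qed.

(** The exchange condition. The deleted letter is the one that creates the descent: when u has an
    ascent at i and the letter k reverses it, [gen_conjugate] cancels k against the new letter i. *)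
Lemma word_deletion (s : seq 'I_n.+1) (i : nat) : (1 <= i <= n)%N ->
  word_prod t s (i%:Z + 1) < word_prod t s (root_source t n i) ->
  exists2 s' : seq 'I_n.+1, size s = (size s').+1 & word_prod t s \o gen t n i = word_prod t s'.
Proof.
move=> hi; have n2 := min_rank_ge2 hn; elim: s => [|k s ih] /=.
  (* The identity has no descent, because [root_source t n i < i + 1]. *)
  rewrite /root_source; case: (t) (hn) => /=; do ? case: ifP; lia.
set u := word_prod t s => gu.
have mu : mirrored n u := affine_group_mirrored (affine_group_word hn s).
have hk : (k <= n)%N by rewrite -ltnS.
have [lt_u|le_u] := ltP (u (i%:Z + 1)) (u (root_source t n i)).
  have [s' e1 e2] := ih lt_u; exists (k :: s'); first by rewrite /= e1.
  by rewrite /= -e2.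
exists s => //; rewrite (gen_conjugate hk hi mu) //.
  by apply/funext => z /=; rewrite genK //; lia.
rewrite lt_neqAle le_u andbT (inj_eq (mirrored_inj mu)); apply/eqP => e.
by move: gu; rewrite e ltxx.
Qed.

(** A shortest word exists, so [xget] returns the minimum and not its default 0. *)
Lemma coxeter_lengthP (s : seq 'I_n.+1) :
  (exists2 s0 : seq 'I_n.+1, size s0 = coxeter_length t n (word_prod t s)
     & word_prod t s = word_prod t s0) /\
  forall s0 : seq 'I_n.+1, word_prod t s = word_prod t s0 ->
    (coxeter_length t n (word_prod t s) <= size s0)%N.
Proof.
apply: (@xgetPex _ 0%N [set k | (exists2 s1 : seq 'I_n.+1, size s1 = k
  & word_prod t s = word_prod t s1) /\ forall s1 : seq 'I_n.+1,
  word_prod t s = word_prod t s1 -> (k <= size s1)%N]%classic).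
have [s1 e1 h1] :=
  @minimizer_exists _ (fun s1 : seq 'I_n.+1 => word_prod t s = word_prod t s1) size s erefl.
by exists (size s1); split => //; exists s1.
Qed.

(** A descent at i >= 1 would, by [word_deletion], give a shorter element of the same coset. *)
Lemma min_coset_reps_ascent w (i : nat) : min_coset_reps t n w ->
  (1 <= i <= n)%N -> w (root_source t n i) < w (i%:Z + 1).
Proof.
move=> [aw wmin] hi; have mw := affine_group_mirrored aw.
have [s es] := affine_group_generated hn aw.
have [[s0 sz0 es0] _] := coxeter_lengthP s.
have src : root_source t n i != i%:Z + 1.
  by rewrite /root_source; case: (t) (hn) => /=; do ? case: ifP; lia.
have : w (root_source t n i) != w (i%:Z + 1) by rewrite (inj_eq (mirrored_inj mw)).
case: ltgtP => // lt_w _; exfalso.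
rewrite -es in sz0 es0; rewrite es0 in lt_w.
have [s1 sz1 es1] := word_deletion hi lt_w; rewrite -es0 in es1.
have hi' : (i < n.+1)%N by lia.
have [_ /(_ s1 erefl) le1] := coxeter_lengthP s1.
have : parabolic t n (gen t n i).
  by exists [:: Ordinal hi'] => //; rewrite inE -val_eqE /=; lia.
by move/wmin; rewrite es1 -sz0 sz1; lia.
Qed.

Lemma min_coset_reps_exists w : affine_group t n w ->
  exists2 u, parabolic t n u & min_coset_reps t n (w \o u).
Proof.
move=> aw; have [s es] := affine_group_generated hn aw.
have [|u pu umin] := @minimizer_exists _ (parabolic t n)
  (fun u => coxeter_length t n (w \o u)) id.
  by exists [::].
exists u => //; split=> [|u' [s' s'0 eu']].
  by case: pu => s' _ ->; rewrite es -word_prod_cat; apply: affine_group_word.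
apply: (umin (u \o u')); case: pu => s1 s10 ->; exists (s1 ++ s').
  by rewrite mem_cat negb_or s10.
by rewrite word_prod_cat eu'.
Qed.

End Length.

                                

(** * The image of the origin and the levels of the abacus *)

Section Origin.
Variables (R : realType) (n : nat).
Implicit Types v : 'rV[R]_n.

Lemma hat_opp v (p : nat) : (1 <= p <= n)%N ->
  hat v (- p%:Z) = 1 - dot v (evec R n p).
Proof. by move=> hp; rewrite hatN hat_window. Qed.

Lemma hat_period_sub v (p : nat) : (1 <= p <= n)%N ->
  hat v (period n - p%:Z) = - dot v (evec R n p).
Proof. by move=> hp; rewrite addrC hatD hat_opp //; ring. Qed.

Lemma act0_id v : act0 id v = v.
Proof.
apply/rowP => j; rewrite mxE (@int_preimE id id) // hat_window ?dot_evec //=.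
Qed.

Lemma act0_comp u w v : mirrored n u -> mirrored n w ->
  act0 (u \o w) v = act0 u (act0 w v).
Proof.
move=> mu mw; have [u' [uK u'K _]] := mirrored_inverse mu.
have [w' [wK w'K _]] := mirrored_inverse mw.
apply/rowP => j; rewrite !mxE hat_act0 // (int_preimE uK u'K) (int_preimE wK w'K).
by rewrite (@int_preimE _ (w' \o u')) // => z /=; rewrite ?uK ?wK ?w'K ?u'K.
Qed.

Lemma dot0 v : dot 0 v = 0 :> R.
Proof. by rewrite /dot big1 // => i _; rewrite mxE mul0r. Qed.

Lemma hat0E (m : int) (r : nat) : (r <= 2 * n)%N ->
  hat (0 : 'rV[R]_n) (m * period n + r%:Z) = (if r == 0%N then 2^-1 else 0) - m%:~R.
Proof. by move=> hr; rewrite hatE // !dot0 oppr0 if_same. Qed.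

Lemma hat0_rounded (z : int) : (forall m, z != m * period n) ->
  hat (0 : 'rV[R]_n) z = (- rounded n 0 z)%:~R.
Proof.
move=> hz; have [m [r [hr e]]] := intN_split n z.
have r0 : r != 0%N by apply/eqP => r0; have /eqP := hz m; rewrite e r0 addr0.
rewrite e hat0E // (negbTE r0) sub0r roundedE ?rmorphN //.
by rewrite /period; lia.
Qed.

(** Recovers the block 1, ..., 2n from the origin as the zero set of [hat 0]; at multiples of the
    period the value is a half-integer, hence nonzero. *)
Lemma hat0_eq0 (z : int) : hat (0 : 'rV[R]_n) z = 0 <-> 0 < z < period n.
Proof.
have [m [r [hr ->]]] := intN_split n z; rewrite hat0E //.
have PE : period n = 2 * n%:Z + 1 by rewrite /period; lia.
case: eqP => [->|/eqP r0]; split.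
- move=> h; have : (2 * m)%:~R = 1%:~R :> R by rewrite intrM; lra.
  by move/intr_inj; lia.
- by have : m <= 0 \/ m >= 1 by [lia]; case=> hm; nia.
- by move=> /eqP; rewrite sub0r oppr_eq0 intr_eq0 => /eqP ->; lia.
- move=> h; have -> : m = 0 by have : m = 0 \/ m <= -1 \/ m >= 1 by [lia]; case=> [//|[]]; nia.
  by rewrite subr0.
Qed.

Lemma act0_origin w w' : mirrored n w -> cancel w w' ->
  act0 w 0 = \sum_(i < n) (- rounded n 0 (w' i.+1%:Z))%:~R *: evec R n i.+1.
Proof.
move=> mw wK; have w'K := mirrored_canV mw wK; have mw' := mirrored_can mw wK.
apply/rowP => j; rewrite mxE (int_preimE wK w'K) summxE (bigD1 j) //= big1.
  rewrite addr0 hat0_rounded => [|m].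
    by rewrite !mxE eqxx mulr1.
  by apply: mirrored_nonmultiple => //; have := ltn_ord j; lia.
by move=> i ij; rewrite !mxE eqSS (inj_eq val_inj) eq_sym (negbTE ij) mulr0.
Qed.

End Origin.

Section Action.
Variables (R : realType) (t : quotient_type) (n : nat).
Hypothesis hn : (min_rank t <= n)%N.
Implicit Types v : 'rV[R]_n.

(** Reflecting v amounts to permuting the values of [hat v], which makes [act0] correct on
    generators. *)
Lemma gen_reflectionE (i : nat) v (j : 'I_n) : (i <= n)%N ->
  gen_reflection t i v 0 j = hat v (gen_window t n i j.+1).
Proof.
move=> hi; have n2 := min_rank_ge2 hn.
have hj : (1 <= j.+1 <= n)%N by have := ltn_ord j; lia.
have hatE p : (1 <= p <= n)%N -> hat v p%:Z = dot v (evec R n p) by exact: hat_window.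
have norm1 p : (1 <= p <= n)%N -> dot (evec R n p) (evec R n p) = 1.
  by move=> hp; rewrite dot_evec2 // eqxx.
have norm2 p : (1 <= p <= n)%N -> dot (2 *: evec R n p) (2 *: evec R n p) = 4.
  by move=> hp; rewrite dotZr dotC dotZr norm1 //; ring.
have normD p q : (1 <= p <= n)%N -> (1 <= q <= n)%N -> p != q ->
    dot (evec R n p + evec R n q) (evec R n p + evec R n q) = 2.
  move=> hp hq pq; rewrite !dotDr !dotDl !dot_evec2 //.
  by rewrite [q == p]eq_sym (negbTE pq) !eqxx /=; ring.
have normB p q : (1 <= p <= n)%N -> (1 <= q <= n)%N -> p != q ->
    dot (evec R n p - evec R n q) (evec R n p - evec R n q) = 2.
  move=> hp hq pq; rewrite !(dotDr, dotNr) !(dotDl, dotNl) !dot_evec2 //.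
  by rewrite [q == p]eq_sym (negbTE pq) !eqxx /=; ring.
have vE : v 0 j = dot v (evec R n j.+1) by rewrite dot_evec.
rewrite /gen_reflection.
case: (gen_windowP hn hi) => [k hk|ht|ht n3|ht|ht n3].
- rewrite ifN; last lia.
  rewrite /simple_root ifT; last lia.
  rewrite normB ?(dotDr, dotNr) ?mxE ?vE /s_mid; try lia.
  move: (j.+1) hj => p hp; case: eqVneq => [->|pk].
    rewrite (_ : k%:Z + 1 = k.+1%:Z) ?hatE //; try lia.
    by rewrite (ltn_eqF (ltnSn k)) /=; field.
  case: eqVneq => [->|pk']; rewrite hatE //=; try lia; by field.
- have -> : affine_root R t n = 2 *: evec R n 1 by rewrite /affine_root; case: ht => ->.
  rewrite eqxx norm2 ?dotZr ?mxE ?vE /s0C; last lia.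
  move: (j.+1) hj => p hp; case: eqVneq => [->|p1] /=; last by rewrite hatE //; field.
  by rewrite (hat_opp v (p := 1)) /=; [by field|lia].
- have -> : affine_root R t n = evec R n 1 + evec R n 2.
    by rewrite /affine_root; case: ht => ->.
  rewrite eqxx normD ?dotDr ?mxE ?vE /s0D; try lia.
  move: (j.+1) hj => p hp; case: eqVneq => [->|p1] /=.
    by rewrite (hat_opp v (p := 2)) /=; [by field|lia].
  case: eqVneq => [->|p2] /=; last by rewrite hatE //; field.
  by rewrite (hat_opp v (p := 1)) /=; [by field|lia].
- have -> : simple_root R t n n = (if t is CC then 2 else 1 : R) *: evec R n n.
    by rewrite /simple_root ltnn; case: ht => -> /=; rewrite ?scale1r.
  (* The roots 2e_n and e_n define the same reflection; a nonzero scalar covers both. *)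
  set c := (if t is CC then 2 else 1 : R); have c0 : c != 0.
    by rewrite /c; case: (t); rewrite ?oner_eq0 ?pnatr_eq0.
  rewrite ifN; last lia.
  have -> : dot (c *: evec R n n) (c *: evec R n n) = c * c.
    by rewrite dotZr dotC dotZr norm1; [ring|lia].
  rewrite dotZr !mxE vE /snC.
  move: (j.+1) hj => p hp; case: eqVneq => [->|p1] /=; last by rewrite hatE //; field.
  rewrite (_ : n%:Z + 1 = period n - n%:Z) ?(hat_period_sub v (p := n)); try (rewrite /period; lia).
  by field.
have -> : simple_root R t n n = evec R n n.-1 + evec R n n.
  by rewrite /simple_root ltnn; case: ht => ->.
rewrite ifN; last lia.
rewrite normD ?dotDr ?mxE ?vE /snD; try lia.
move: (j.+1) hj => p hp; case: eqVneq => [->|p1].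
  rewrite (_ : n%:Z + 1 = period n - n%:Z) ?(hat_period_sub v (p := n)); try (rewrite /period; lia).
  have -> : (n.-1 == n) = false by lia.
  by rewrite /=; field.
case: eqVneq => [->|p2] /=; last by rewrite hatE //; field.
rewrite (_ : n%:Z + 2 = period n - n.-1%:Z) ?(hat_period_sub v (p := n.-1)); try (rewrite /period; lia).
by field.
Qed.

Lemma act0_gen (i : nat) v : (i <= n)%N -> act0 (gen t n i) v = gen_reflection t i v.
Proof.
move=> hi; have n2 := min_rank_ge2 hn; have gK := genK t n2 hi.
apply/rowP => j; rewrite gen_reflectionE // mxE (int_preimE gK gK) gen_windowE //.
exact: ltn_ord.
Qed.

Lemma act_word act (s : seq 'I_n.+1) v : geometric_action t act ->
  act (word_prod t s) v = act0 (word_prod t s) v.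
Proof.
move=> hact; elim: s => [|k s ih] /=; first by rewrite (action_id hact) act0_id.
have hk : (k <= n)%N by rewrite -ltnS.
have ag := affine_group_comp_gen hn hk (affine_group_id hn).
have aw := affine_group_word hn s.
rewrite (action_comp hact) // (action_gen hact) // ih -act0_gen // act0_comp //.
  exact: affine_group_mirrored ag.
exact: affine_group_mirrored aw.
Qed.

End Action.

(** If the lowest bead of the runner is mN + i = w(k), then w^-1(i) = -mN + k with 0 < k < N, whose
    floor is -m. *)
Lemma level_abacus (n : nat) w w' (i : nat) : mirrored n w -> cancel w w' ->
  (1 <= i <= 2 * n)%N -> level n (abacus n w) i = - rounded n 0 (w' i%:Z).
Proof.
move=> mw wK hi; have w'K := mirrored_canV mw wK; have mw' := mirrored_can mw wK.
have [_ _ /(_ i hi)[m low_m [k hk ek]]] := abacus_ofP mw.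
have -> : level n (abacus n w) i = m.
  apply: xget_unique => // m' low_m'; apply/eqP.
  by rewrite eq_le (low_m.2 _ low_m'.1) (low_m'.2 _ low_m.1).
have -> : w' i%:Z = - m * period n + k%:Z.
  rewrite -(wK k%:Z) -ek /label -(mirroredM _ _ mw'); congr w'; ring.
by rewrite roundedE ?opprK //; rewrite /period; lia.
Qed.

                                     

(** * Minimal representatives and lattice points *)

Lemma increasing_interval_id (m : nat) (u : int -> int) :
  (forall k : nat, (1 <= k <= m)%N -> 1 <= u k%:Z <= m%:Z) ->
  (forall k : nat, (1 <= k < m)%N -> u k%:Z < u k.+1%:Z) ->
  forall k : nat, (1 <= k <= m)%N -> u k%:Z = k%:Z.
Proof.
move=> ub ui.
have up i k : (1 <= i)%N -> (i + k <= m)%N -> u i%:Z + k%:Z <= u (i + k)%N%:Z.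
  move=> hi; elim: k => [|k ih] hk; first by rewrite addn0 addr0.
  by have := ui (i + k)%N; rewrite addnS; lia.
move=> k hk; have := up 1%N k.-1; have := up k (m - k)%N.
rewrite (_ : 1 + k.-1 = k)%N; last by lia.
rewrite (_ : k + (m - k) = m)%N; last by lia.
by have := ub 1%N; have := ub m; lia.
Qed.

Section Cosets.
Variables (R : realType) (n : nat).
Hypothesis n2 : (2 <= n)%N.

Definition increasing_window (w : int -> int) : Prop :=
  forall i : nat, (1 <= i <= n)%N -> w i%:Z < w i.+1%:Z.

(** The mirror i -> N - i carries the ascents on 1, ..., n + 1 to ascents on n, ..., 2n. *)
Lemma increasing_window_block w : mirrored n w -> increasing_window w ->
  forall k l : nat, (1 <= k)%N -> (k <= l <= 2 * n)%N -> w k%:Z <= w l%:Z.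
Proof.
move=> mw iw; have step (k : nat) : (1 <= k < 2 * n)%N -> w k%:Z < w k.+1%:Z.
  move=> hk; have [kn|nk] := leqP k n; first by apply: iw; lia.
  have := iw (2 * n - k)%N ltac:(lia).
  rewrite (_ : (2 * n - k)%N%:Z = 1 * period n - k.+1%:Z); last by rewrite /period; lia.
  rewrite (_ : (2 * n - k).+1%:Z = 1 * period n - k%:Z); last by rewrite /period; lia.
  by rewrite !(mirroredB mw); lia.
move=> k l k1 /andP[kl l2]; rewrite -(subnKC kl) in l2 *.
elim: (l - k)%N l2 => [|d ih] hd; first by rewrite addn0.
by have := step (k + d)%N; have := ih; rewrite addnS; lia.
Qed.

(** Equal images of the origin make w^-1 w' preserve the zero set of [hat 0], that is, the block 1,
    ..., 2n. Both factors being monotone there, it is the identity on the block. *)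
Lemma increasing_window_inj w w' : mirrored n w -> mirrored n w' ->
  increasing_window w -> increasing_window w' ->
  act0 w (0 : 'rV[R]_n) = act0 w' 0 -> w = w'.
Proof.
move=> mw mw' iw iw' eqw.
have [v [wK vK mv]] := mirrored_inverse mw; have [v' [w'K v'K mv']] := mirrored_inverse mw'.
have block k : 0 < k < period n -> 0 < v (w' k) < period n.
  move=> /(hat0_eq0 R) hk; apply/(hat0_eq0 R); apply: etrans hk; rewrite -{2}(w'K k).
  by rewrite -(int_preimE wK vK) -(int_preimE w'K v'K) -!hat_act0 // eqw.
have PE : period n = 2 * n%:Z + 1 by rewrite /period; lia.
have incr := increasing_window_block mw iw.
have incr' := increasing_window_block mw' iw'.
have id_block : forall k : nat, (1 <= k <= 2 * n)%N -> v (w' k%:Z) = k%:Z.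
  apply: (@increasing_interval_id (2 * n) (v \o w')) => k hk /=.
    by have := block k%:Z; lia.
  rewrite ltNge; apply/negP => le_v.
  have b1 := block k%:Z ltac:(lia); have b2 := block k.+1%:Z ltac:(lia).
  have [x ex] : exists x : nat, v (w' k%:Z) = x%:Z by exists (absz (v (w' k%:Z))); lia.
  have [y ey] : exists y : nat, v (w' k.+1%:Z) = y%:Z by exists (absz (v (w' k.+1%:Z))); lia.
  have := incr y x ltac:(lia) ltac:(lia); rewrite -ex -ey !vK.
  have := incr' k k.+1 ltac:(lia) ltac:(lia).
  have : w' k%:Z != w' k.+1%:Z by rewrite (inj_eq (mirrored_inj mw')); lia.
  lia.
apply: (mirrored_ext mw mw') => j hj.
by rewrite -(vK (w' j%:Z)) id_block //; lia.
Qed.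

                                                                                 
                      
(** The element s_n^C. It fixes the origin and flips the parity at n, so composing with it leaves
    the groups of types [BD] and [DD] without moving the image of the origin. *)
Let sigma := gen CC n n.

Lemma act0_sigma w : mirrored n w -> act0 (w \o sigma) (0 : 'rV[R]_n) = act0 w 0.
Proof.
move=> mw; have hn : (min_rank CC <= n)%N by [].
rewrite act0_comp //; last exact: gen_mirrored.
rewrite (act0_gen hn) // /gen_reflection ifN; last by lia.
by rewrite dot0 mul0r scale0r subr0.
Qed.

Lemma sigma_flip w : mirrored n w ->
  odd (window_sum n n (w \o sigma)) = ~~ odd (window_sum n n w).
Proof.
move=> mw; rewrite window_sum_gen //; last by right.
by rewrite eqxx orbT addbT.
Qed.

Lemma sigmaE (j : nat) : (1 <= j <= n)%N ->
  sigma j%:Z = if j == n then n.+1%:Z else j%:Z.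
Proof.
move=> hj; rewrite /sigma gen_windowE // /gen_window ifN ?ltnn; last by lia.
by rewrite /snC; case: eqP => // _; lia.
Qed.

(** With a D-shaped end, minimality gives w(n-1) < w(n+1) but leaves the order of w(n) and w(n+1)
    open; so w or [w \o sigma] has an increasing window. Parity at n excludes that the two elements
    fall into different cases. *)
Lemma min_coset_reps_inj t w w' : (min_rank t <= n)%N ->
  min_coset_reps t n w -> min_coset_reps t n w' ->
  act0 w (0 : 'rV[R]_n) = act0 w' 0 -> w = w'.
Proof.
move=> hn rw rw'.
have mid (x : int -> int) i : min_coset_reps t n x -> (1 <= i < n)%N -> x i%:Z < x i.+1%:Z.
  move=> rx hi; have := min_coset_reps_ascent hn rx (i := i) ltac:(lia).
  by rewrite root_source_mid // (_ : i%:Z + 1 = i.+1%:Z) //; lia.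
have mw := affine_group_mirrored rw.1; have mw' := affine_group_mirrored rw'.1.
have tn : (t = CC \/ t = BB) \/ (t = BD \/ t = DD) by case: (t); tauto.
case: tn => ht.
  have incr x : min_coset_reps t n x -> increasing_window x.
    move=> rx i hi; have [->|ni] := eqVneq i n; last by apply: mid => //; lia.
    have := min_coset_reps_ascent hn rx (i := n) ltac:(lia).
    by rewrite root_sourcenC // (_ : n%:Z + 1 = n.+1%:Z) //; lia.
  by apply: increasing_window_inj => //; apply: incr.
have sK : involutive sigma by apply: genK.
have ms : mirrored n sigma by apply: gen_mirrored.
have sn : sigma n%:Z = n.+1%:Z by rewrite sigmaE ?eqxx //; lia.
have sn1 : sigma n.+1%:Z = n%:Z by rewrite -sn sK.
have incr x : min_coset_reps t n x -> increasing_window x \/ increasing_window (x \o sigma).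
  move=> rx; have mx := affine_group_mirrored rx.1.
  have := min_coset_reps_ascent hn rx (i := n) ltac:(lia).
  rewrite root_sourcenD // (_ : n%:Z + 1 = n.+1%:Z); last by lia.
  move=> xn1; case: (ltgtP (x n%:Z) (x n.+1%:Z)) => [lt_x|gt_x|/(mirrored_inj mx)]; last by lia.
    by left=> i hi; have [->|ni] := eqVneq i n; last by apply: mid => //; lia.
  right=> i hi /=; have [->|ni] := eqVneq i n.
    by rewrite sn1 sn.
  rewrite !sigmaE ?(negbTE ni); [|lia|lia].
  case: eqP => [in1|_]; last by apply: mid => //; lia.
  by have -> : i = n.-1 by lia.
have even_n x : min_coset_reps t n x -> ~~ odd (window_sum n n x).
  by move=> [/affine_groupP[_ _ +] _]; case: ht => ->.
have no_flip x y : min_coset_reps t n x -> min_coset_reps t n y -> x = y \o sigma -> False.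
  move=> rx ry exy; have := even_n x rx; rewrite exy sigma_flip ?even_n //.
  exact: affine_group_mirrored ry.1.
have cancel_s (x y : int -> int) : x \o sigma = y -> x = y \o sigma.
  by move=> <-; apply/funext => z /=; rewrite sK.
move=> eqw; case: (incr w rw) (incr w' rw') => iw [] iw'.
- exact: increasing_window_inj eqw.
- case: (no_flip w w') => //; apply: increasing_window_inj => //.
    exact: mirrored_comp.
  by rewrite act0_sigma.
- case: (no_flip w w') => //; apply: cancel_s; apply: increasing_window_inj => //.
    exact: mirrored_comp.
  by rewrite act0_sigma.
rewrite (cancel_s w (w' \o sigma)); first by apply/funext => z /=; rewrite sK.
by apply: increasing_window_inj; rewrite ?act0_sigma //; apply: mirrored_comp.
Qed.

(** The group element that acts on the origin as translation by the vector b. *)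
Definition translation (b : nat -> int) : int -> int :=
  mirror_ext n (fun j => j%:Z + b j * period n).

Lemma translation_window b (j : nat) : (1 <= j <= n)%N ->
  translation b j%:Z = b j * period n + j%:Z.
Proof. by move=> hj; rewrite /translation mirror_ext_window // addrC. Qed.

Lemma translationK b : cancel (translation b) (translation (fun j => - b j)).
Proof.
apply: (@window_eq int n (period n) 0) => // [z|z|z|j hj].
- by rewrite /translation !mirror_extD.
- by rewrite /translation !mirror_extN sub0r.
- by rewrite sub0r.
rewrite translation_window // /translation mirror_extE; last by lia.
by rewrite ifN ?ifT; [ring|lia|lia].
Qed.

Lemma translation_mirrored b : mirrored n (translation b).
Proof.
split; last exact: mirror_extN.
  exists (translation (fun j => - b j)); first exact: translationK.
  have := translationK (fun j => - b j).
  by rewrite (_ : (fun j => - - b j) = b) //; apply/funext => j; rewrite opprK.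
exact: mirror_extD.
Qed.

Lemma rounded_translation b c (j : nat) : (c <= n)%N -> (1 <= j <= n)%N ->
  rounded n c (translation b j%:Z) = b j.
Proof.
by move=> hc hj; rewrite translation_window // roundedE //; rewrite /period; lia.
Qed.

Lemma window_sum_translation b c : (c <= n)%N ->
  window_sum n c (translation b) = (\sum_(j < n) `|b j.+1|)%N.
Proof.
move=> hc; apply: eq_bigr => j _; rewrite rounded_translation //.
by have := ltn_ord j; lia.
Qed.

Lemma act0_translation b :
  act0 (translation b) (0 : 'rV[R]_n) = \sum_(i < n) (b i.+1)%:~R *: evec R n i.+1.
Proof.
rewrite (act0_origin R (translation_mirrored b) (translationK b)).
apply: eq_bigr => i _; rewrite rounded_translation ?opprK //.
by have := ltn_ord i; lia.
Qed.

Lemma lattice_point_act0 t (p : 'rV[R]_n) : integer_points t p ->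
  exists2 w, affine_group t n w & act0 w 0 = p.
Proof.
move=> [a [par ->]].
(* Shifts the index to start from 1; the default 0 lies outside the window and has no effect. *)
pose b (j : nat) : int := oapp a 0 (insub j.-1 : option 'I_n).
have bE (i : 'I_n) : b i.+1 = a i by rewrite /b /= valK.
have pE : \sum_i (a i)%:~R *: evec R n i.+1 = act0 (translation b) 0.
  by rewrite act0_translation; apply: eq_bigr => i _; rewrite bE.
have sE c : (c <= n)%N -> window_sum n c (translation b) = (\sum_i `|a i|)%N.
  by move=> hc; rewrite window_sum_translation //; apply: eq_bigr => i _; rewrite bE.
have mT := translation_mirrored b.
rewrite pE; case: t par => par.
- by exists (translation b) => //; apply/affine_groupP.
- by exists (translation b) => //; apply/affine_groupP; rewrite sE.
(* Type [BD] accepts all lattice points: a wrong parity at n is repaired by [sigma], which keeps the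
   image of the origin. *)
- case ev : (odd (window_sum n n (translation b))).
    exists (translation b \o sigma); last exact: act0_sigma.
    apply/affine_groupP; split => //; last by rewrite sigma_flip // ev.
    by apply: mirrored_comp => //; apply: gen_mirrored.
  by exists (translation b) => //; apply/affine_groupP; rewrite ev.
by exists (translation b) => //; apply/affine_groupP; rewrite !sE.
Qed.

End Cosets.

Theorem theorem4p1 (R : realType) (t : quotient_type) (n : nat)
    (hn : (min_rank t <= n)%N)
    (act : (int -> int) -> 'rV[R]_n -> 'rV[R]_n)
    (hact : geometric_action t act) :
  (forall w : int -> int, min_coset_reps t n w ->
     act w 0 = \sum_(i < n) (level n (abacus n w) i.+1)%:~R *: evec R n i.+1) /\
  set_bij (min_coset_reps t n) (@integer_points R t n) (fun w => act w 0).
Proof.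
have n2 := min_rank_ge2 hn.
have actE w v : affine_group t n w -> act w v = act0 w v.
  by move=> /(affine_group_generated hn)[s ->]; apply: act_word.
have originE w : affine_group t n w ->
    act w 0 = \sum_(i < n) (level n (abacus n w) i.+1)%:~R *: evec R n i.+1.
  move=> aw; have mw := affine_group_mirrored aw.
  have [v [wK _ _]] := mirrored_inverse mw.
  rewrite actE // (act0_origin R mw wK); apply: eq_bigr => i _.
  by rewrite (level_abacus mw wK) //; have := ltn_ord i; lia.
split; first by move=> w [aw _]; apply: originE.
split.
- move=> w [aw _] /=; rewrite originE //.
  exists (fun i : 'I_n => level n (abacus n w) i.+1); split => //.
  have [mw e0 _] := (affine_groupP t n w).1 aw.
  have [v [wK _ _]] := mirrored_inverse mw.
  (* The levels are the negated floors for w^-1, while the parity condition concerns those for w. *)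
  have -> : (\sum_(i < n) `|level n (abacus n w) i.+1|)%N = window_sum n 0 w.
    rewrite (window_sum0_inverse mw wK); apply: eq_bigr => i _.
    by rewrite (level_abacus mw wK) ?abszN //; have := ltn_ord i; lia.
  by move: e0; case: (t).
- move=> w w' /set_mem rw /set_mem rw' /=.
  by rewrite (actE w _ rw.1) (actE w' _ rw'.1); exact: (min_coset_reps_inj n2 hn rw rw').
move=> p /(lattice_point_act0 n2)[w aw <-].
have [u [s s0 eu] rwu] := min_coset_reps_exists hn aw.
exists (w \o u) => //=; have au : affine_group t n u by rewrite eu; apply: affine_group_word.
rewrite (action_comp hact) // (actE w) //; congr act0.
(* What remains is that u fixes the origin: its letters are nonzero, and their reflections are
   linear. *)
rewrite eu; elim: s s0 {eu} => [|k s ih] /=; first by rewrite (action_id hact).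
rewrite inE negb_or => /andP[k0 s0].
have hk : (k <= n)%N by rewrite -ltnS.
rewrite (action_comp hact) ?ih //; first last.
- exact: affine_group_word.
- exact: (affine_group_comp_gen hn hk (affine_group_id hn)).
rewrite (action_gen hact) // /gen_reflection ifN ?dot0 ?mul0r ?scale0r ?subr0 //.
by rewrite eq_sym.
Qed.
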